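(* Let $\lambda\in\mathbb{C}$ with $|\lambda|<1$, let $V$ and $U$ be the (almost everywhere defined) functions on $[-1,1]$ given in the context, and let $(\mathcal{R}_{\pm}h)(x)=h\!\left(\frac{x\pm1}{2}\right)$ on $L^2(-1,1)$. Then the following hold. **(i)** For every $f\in L^2(-1,1)$, $$\int_{-1}^1U(x)f(x)\,dx=\int_{-1}^1V(x)\left(1-\lambda\frac{\mathcal{R}_++\mathcal{R}_-}2\right)^{-1}f(x)\,dx-\frac1{1-\lambda}\int_{-1}^1f(x)\,dx.$$ **(ii)** Let $N\ge0$ be even and let $P(x)=\sum_{n=0}^{N/2}p_nx^{2n}$ with $p_n\in\mathbb{C}$. Then $$\int_{-1}^1U(x)P(x)\,dx=\frac{\det M}{-\prod_{n=0}^{N/2}\left(1-\frac{\lambda}{4^n}\right)}-\sum_{n=0}^{N/2}\frac{2p_n}{(1-\lambda)(2n+1)},$$ where $M$ is the $(\frac N2+2)\times(\frac N2+2)$ matrix with rows and columns indexed by $0,\dots,\frac N2+1$ whose entries are, for $0\le n,m\le\frac N2$, $$M_{n,n}=1-\frac{\lambda}{2^{2n}},\qquad M_{n,m}=\frac{-\lambda\binom{2n}{2m}}{2^{2n}}\ (m<n),\qquad M_{n,m}=0\ (m>n),$$ with last column $M_{n,\frac N2+1}=\int_{-1}^1V(x)x^{2n}\,dx$ $(0\le n\le\frac N2)$, last row $M_{\frac N2+1,m}=p_m$ $(0\le m\le\frac N2)$, and $M_{\frac N2+1,\frac N2+1}=0$. In particular, for even $N\ge0$, $$\int_{-1}^1U(x)x^N\,dx=\frac{\det\widetilde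 M}{\prod_{n=0}^{N/2}\left(1-\frac{\lambda}{4^n}\right)}-\frac{2}{(1-\lambda)(N+1)},$$ where $\widetilde M$ is the $(\frac N2+1)\times(\frac N2+1)$ matrix obtained from $M$ by deleting row $\frac N2+1$ and column $\frac N2$. If $N$ is odd, then $\int_{-1}^1U(x)x^N\,dx=0$. **(iii)** Define $P_n(x):=2^nB_n\!\left(\frac{x+1}2\right)$, $n\ge0$, where $B_n$ are the classical Bernoulli polynomials. Then $$\int_{-1}^1U(x)P_n(x)\,dx=\frac{1}{1-2^{-n}\lambda}\int_{-1}^1V(x)P_n(x)\,dx-\frac{2\delta_{n0}}{1-\lambda},\qquad n\ge0,$$ where $\delta$ is the Kronecker delta. In particular, for even $N\ge0$, $$\int_{-1}^1U(x)x^N\,dx=\int_{-1}^1V(x)Q_N(x)\,dx-\frac{2}{(1-\lambda)(N+1)},\qquad Q_N(x)=\sum_{j=0}^{N/2}\frac{\binom{N}{2j}}{(1-2^{2j-N}\lambda)(2j+1)}P_{N-2j}(x).$$ Moreover, with $\mathcal{D}=\frac{d}{dx}$, the polynomials $P_n$ satisfy $$\sum_{n=0}^{\infty}P_n(x)\frac{t^n}{n!}=\frac{t}{\sinh t}e^{tx},\qquad P_n(x)=\frac{\mathcal{D}}{\sinh\mathcal{D}}x^n,\qquad \mathcal{D}P_n(x)=nP_{n-1}(x).$$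
   Context: Every $x\in[-1,1]$ outside a countable set of dyadic rationals has a unique expansion $$x=\frac{x_0}{2}+\frac{x_1}{2^2}+\frac{x_2}{2^3}+\cdots,\qquad x_n\in\{-1,+1\}.$$ For $\lambda\in\mathbb{C}$, $|\lambda|<1$, define (for almost every $x\in[-1,1]$) $$V(x)=1+\sum_{n=0}^{\infty}\lambda^{n+1}L_n(x),\qquad L_n(x)=\begin{cases}1,&\sum_{j=0}^nx_j=0,\\0,&\text{otherwise,}\end{cases}$$ $$U(x)=\sum_{0\le m\le n<\infty}\lambda^{n+1}L_{mn}(x),\qquad L_{mn}(x)=\begin{cases}1,&\sum_{j=m}^nx_j=0,\\0,&\text{otherwise.}\end{cases}$$ Both functions are bounded and measurable; integrals are Lebesgue integrals, so the values on the exceptional countable set do not matter. The inverse in (i) is the inverse of a bounded operator on $L^2(-1,1)$, applied to $f$. The classical Bernoulli polynomials are defined by $\frac{te^{xt}}{e^t-1}=\sum_{n\ge0}B_n(x)\frac{t^n}{n!}$. The operator $\frac{\mathcal{D}}{\sinh\mathcal{D}}$ acts on polynomials by substituting $\mathcal{D}$ into the Taylor series of $\frac{t}{\sinh t}$ at $t=0$ (only finitely many terms act nontrivially on a given polynomial). The generating function identity is an identity of power series in $t$ (valid for $|t|<\pi$). The relation $\mathcal{D}P_n=nP_{n-1}$ is for $n\ge1$ (and $\mathcal{D}P_0=0$). *)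

(* Defs.v *)
From HB Require Import structures.
From mathcomp Require Import all_boot all_order all_algebra.
From mathcomp Require Import all_classical all_reals all_analysis.
From mathcomp Require Import complex.

Set Implicit Arguments.
Unset Strict Implicit.
Unset Printing Implicit Defensive.

Import Order.TTheory GRing.Theory Num.Theory.
Import numFieldNormedType.Exports.

Local Open Scope classical_set_scope.
Local Open Scope complex_scope.
Local Open Scope ring_scope.

(* The norm topology of the numeric field [R[i]] lives on its alias
   [R[i]^o]. *)

Definition csum (R : realType) (u : nat -> R[i]) : R[i] :=
  lim (series (u : nat -> R[i]^o) @ \oo).

Definition cexp (R : realType) (z : R[i]) : R[i] :=
  csum (fun n => z ^+ n / n`!%:R).

Definition csinh (R : realType) (z : R[i]) : R[i] :=
  (cexp z - cexp (- z)) / 2%:R.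

(* The removable singularity of t / sinh t at 0 is filled in. *)
Definition t_over_sinh (R : realType) (t : R[i]) : R[i] :=
  if t == 0 then 1 else t / csinh t.

Definition I11 (R : realType) : set R := `]-1, 1[.

Definition cint (R : realType) (f : R -> R[i]) : R[i] :=
  (\int[@lebesgue_measure R]_(x in @I11 R) complex.Re (f x)) +i*
  (\int[@lebesgue_measure R]_(x in @I11 R) complex.Im (f x)).

(* Elements of L^2(-1, 1) are represented by functions [R -> R[i]], of which
   only the values on (-1, 1) matter, up to [ae11]; operators on L^2(-1, 1)
   are represented by maps that respect [ae11]. *)

Definition ae11 (R : realType) (f g : R -> R[i]) : Prop :=
  f = g %[ae @lebesgue_measure R in @I11 R].

Definition sqnorm (R : realType) (z : R[i]) : R := complex.Re (`|z| ^+ 2).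

Definition L2 (R : realType) (f : R -> R[i]) : Prop :=
  [/\ measurable_fun (@I11 R) (fun x => complex.Re (f x)),
      measurable_fun (@I11 R) (fun x => complex.Im (f x)) &
      (\int[@lebesgue_measure R]_(x in @I11 R) (sqnorm (f x))%:E < +oo)%E].

Definition L2norm (R : realType) (f : R -> R[i]) : R :=
  Num.sqrt (\int[@lebesgue_measure R]_(x in @I11 R) sqnorm (f x)).

Definition L2_bounded_op (R : realType)
    (A : (R -> R[i]) -> (R -> R[i])) : Prop :=
  [/\ forall f, L2 f -> L2 (A f),
      forall f g, L2 f -> L2 g -> ae11 f g -> ae11 (A f) (A g),
      forall (c : R[i]) f g, L2 f -> L2 g ->
        ae11 (A (fun x => c * f x + g x)) (fun x => c * A f x + A g x) &
      exists c : R, forall f, L2 f -> L2norm (A f) <= c * L2norm f].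

Definition L2_inverse (R : realType)
    (A S : (R -> R[i]) -> (R -> R[i])) : Prop :=
  L2_bounded_op S /\
  (forall f, L2 f -> ae11 (S (A f)) f /\ ae11 (A (S f)) f).

Definition Rplus_op (R : realType) (h : R -> R[i]) : R -> R[i] :=
  fun x => h ((x + 1) / 2%:R).

Definition Rminus_op (R : realType) (h : R -> R[i]) : R -> R[i] :=
  fun x => h ((x - 1) / 2%:R).

Definition one_sub_op (R : realType) (lam : R[i]) (h : R -> R[i]) :
    R -> R[i] :=
  fun x => h x - lam * ((Rplus_op h x + Rminus_op h x) / 2%:R).

Definition is_expansion (R : realType) (x : R) (d : nat -> int) : Prop :=
  (forall n, d n = 1 \/ d n = -1) /\
  (series (fun n => (d n)%:~R / 2%:R ^+ n.+1 : R) @ \oo --> x).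

(* A chosen expansion of x: it is the expansion of x except for the countably
   many x that have two of them, and for the x outside [-1, 1], which have
   none. *)
Definition digits (R : realType) (x : R) : nat -> int :=
  xget (fun=> 1) [set d | is_expansion x d].

Definition Lmn (R : realType) (m n : nat) (x : R) : R[i] :=
  (\sum_(m <= j < n.+1) digits x j == 0)%:R.

Definition Vfun (R : realType) (lam : R[i]) (x : R) : R[i] :=
  1 + csum (fun n => lam ^+ n.+1 * Lmn 0 n x).

(* The double series over m <= n converges absolutely for |lam| < 1; it is
   summed over m first. *)
Definition Ufun (R : realType) (lam : R[i]) (x : R) : R[i] :=
  csum (fun n => \sum_(0 <= m < n.+1) lam ^+ n.+1 * Lmn m n x).

Definition Mmat (R : realType) (lam : R[i]) (N : nat) (p : nat -> R[i]) :
    'M[R[i]]_(N./2.+2) :=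
  \matrix_(n < N./2.+2, m < N./2.+2)
    if (n <= N./2)%N then
      if (m <= N./2)%N then
        if n == m then 1 - lam / 2%:R ^+ (2 * n)
        else if (m < n)%N then
          - lam * 'C(2 * n, 2 * m)%:R / 2%:R ^+ (2 * n)
        else 0
      else cint (fun x => Vfun lam x * x%:C ^+ (2 * n))
    else
      if (m <= N./2)%N then p m else 0.

Definition Mtilde (R : realType) (lam : R[i]) (N : nat) (p : nat -> R[i]) :
    'M[R[i]]_(N./2.+1) :=
  row' (inord N./2.+1) (col' (inord N./2) (Mmat lam N p)).

(* Formal power series in t over an integral domain, as coefficient
   sequences.  [fps_div a b] is the series q with q * b = a, which is unique
   for b <> 0; b may have zero constant coefficient, as in t / sinh t. *)

Definition fps_mul (A : idomainType) (a b : nat -> A) : nat -> A :=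
  fun n => \sum_(i < n.+1) a i * b (n - i)%N.

Definition fps_div (A : idomainType) (a b : nat -> A) : nat -> A :=
  xget (fun=> 0) [set q | fps_mul q b = a].

Definition fps_t (A : idomainType) : nat -> A := fun n => (n == 1%N)%:R.

(* e^(at) *)
Definition fps_exp (A : idomainType) (a : A) : nat -> A :=
  fun n => a ^+ n / n`!%:R.

Definition fps_sinh (A : idomainType) : nat -> A :=
  fun n => (fps_exp 1 n - fps_exp (-1) n) / 2%:R.

(* B_n(x) / n! is the coefficient of t^n in t e^(xt) / (e^t - 1), computed
   over the polynomials in x. *)
Definition bernoulli_poly (R : realType) (n : nat) : {poly R[i]} :=
  n`!%:R *: fps_div (fps_mul (@fps_t {poly R[i]}) (fps_exp 'X))
                    (fun k => fps_exp 1 k - (k == 0%N)%:R) n.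

Definition Ppoly (R : realType) (n : nat) : {poly R[i]} :=
  2%:R ^+ n *: (@bernoulli_poly R n \Po ((2%:R : R[i])^-1 *: ('X + 1))).

Definition Qpoly (R : realType) (lam : R[i]) (N : nat) : {poly R[i]} :=
  \sum_(j < N./2.+1)
    ('C(N, 2 * j)%:R /
       ((1 - lam / 2%:R ^+ (N - 2 * j)) * (2 * j + 1)%:R)) *:
    @Ppoly R (N - 2 * j).

(* The derivatives of order at least [size p] of p vanish. *)
Definition D_over_sinhD (R : realType) (p : {poly R[i]}) : {poly R[i]} :=
  \sum_(k < size p) fps_div (@fps_t R[i]) (@fps_sinh R[i]) k *: p^`(k).

(* Main.v *)
Require Import Defs.
From HB Require Import structures.
From mathcomp Require Import all_boot all_order all_algebra.
From mathcomp Require Import all_classical all_reals all_analysis.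
From mathcomp Require Import complex measurable_realfun.
From mathcomp Require Import ring lra zify.

Set Implicit Arguments.
Unset Strict Implicit.
Unset Printing Implicit Defensive.

Import Order.TTheory GRing.Theory Num.Theory.
Import numFieldNormedType.Exports.
Local Open Scope classical_set_scope.
Local Open Scope complex_scope.
Local Open Scope ring_scope.

(** Off the dyadic rationals, x |-> (x + 1) / 2 and x |-> (x - 1) / 2 prepend a
    digit +1 or -1 to the expansion of x, whence the self-similarity
      U((x +- 1) / 2) = V((x +- 1) / 2) - 1 + lam * U(x).
    The integral over (-1, 1) is invariant under the averaging operator
    A h (x) = (h((x + 1) / 2) + h((x - 1) / 2)) / 2.  Hence
      int U (1 - lam A) g = int V g - int g,
      int (1 - lam A) g = (1 - lam) int g,
    and everything amounts to inverting 1 - lam A.  On L^2 this is done by the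
    Neumann series.  On the even monomials 1 - lam A is the triangular block of
    M, and the bordered determinant is Cramer's rule.  Finally P_n is an
    eigenvector of A with eigenvalue 2^-n, by the duplication formula
    sinh 2t = 2 sinh t cosh t applied to the generating function.

    That the generating function converges for |t| < pi is shown without
    complex analysis: multiplying t / sinh t by 1 + (t / pi)^2 removes the
    poles at +- i pi, and the result is the inverse of a power series
    1 + s_1 y + s_2 y^2 + ... in y = t / pi with |s_1| + |s_2| + ... <= 1, so
    its coefficients are bounded by 1. *)

(** * Formal power series *)

(** The generating functions live over [{poly R[i]}], which is not a field, and sinh t has zero
    constant coefficient. Identities between series are therefore proved by multiplying through by
    sinh t or an exponential and cancelling, never by inverting. The Neumann series is summed
    pointwise, almost everywhere, rather than in norm: since averaging preserves the integral of a
    nonnegative function, the averages of |f| ^ 2, weighted by powers of |lam|, have a finite sum at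
    almost every point, and this sum controls everything else. The digits in the definitions of U
    and V are a mere choice and carry no visible measurability. Off the dyadic rationals they are
    the signs along the orbit of an explicit piecewise affine map, and all arguments go through that
    description. For the radius of convergence, the next poles of t / sinh t lie at +- 2 i pi, so
    some room is left once +- i pi is removed. Still, the bound on |s_1| + |s_2| + ... is a
    numerical fact with a thin margin, 53 / 75 + 7 / 24 < 1, and this is what requires an upper
    bound on pi as sharp as 16 / 5. *)

Section FormalPowerSeries.
Variable A : idomainType.
Implicit Types a b c q : nat -> A.

(** Coefficient [n] of a product involves only indices up to [n], so truncations suffice and the
    ring laws are inherited from polynomials. *)
Lemma fps_mul_coef a b n N : (n < N)%N ->
  fps_mul a b n = ((\poly_(i < N) a i) * (\poly_(i < N) b i))`_n.
Proof.
move=> nN; rewrite coefM; apply: eq_bigr => i _.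
rewrite !coef_poly (leq_trans (ltn_ord i) nN).
by rewrite (leq_ltn_trans (leq_subr _ _) nN).
Qed.

Lemma fps_mulC : commutative (@fps_mul A).
Proof. by move=> a b; apply/funext => n; rewrite !(@fps_mul_coef _ _ n n.+1)// mulrC. Qed.

Lemma poly_fps_mul a b n N : (n < N)%N ->
  (\poly_(i < N) fps_mul a b i)`_n =
  ((\poly_(i < N) a i) * (\poly_(i < N) b i))`_n.
Proof. by move=> nN; rewrite coef_poly nN; exact: fps_mul_coef. Qed.

Lemma fps_mulA : associative (@fps_mul A).
Proof.
move=> a b c; apply/funext => n.
rewrite !(@fps_mul_coef _ _ n n.+1)//.
transitivity ((\poly_(i < n.+1) a i * (\poly_(i < n.+1) b i * \poly_(i < n.+1) c i))`_n).
  by rewrite !coefM; apply: eq_bigr => i _; rewrite poly_fps_mul// ltnS leq_subr.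
by rewrite mulrA !coefM; apply: eq_bigr => i _; rewrite poly_fps_mul.
Qed.

Definition fps_one : nat -> A := fun n => (n == 0%N)%:R.

Lemma fps_mul1 : left_id fps_one (@fps_mul A).
Proof.
move=> a; apply/funext => n; rewrite /fps_mul big_ord_recl /= mul1r subn0.
by rewrite big1 ?addr0// => i _; rewrite /fps_one/= mul0r.
Qed.

HB.instance Definition _ :=
  Monoid.isComLaw.Build (nat -> A) fps_one (@fps_mul A) fps_mulA fps_mulC fps_mul1.

Lemma fps_mulDl a b c : fps_mul (fun n => a n + b n) c =
  (fun n => fps_mul a c n + fps_mul b c n).
Proof.
by apply/funext => n; rewrite /fps_mul -big_split; apply: eq_bigr => i _; rewrite mulrDl.
Qed.

Lemma fps_mulBl a b c : fps_mul (fun n => a n - b n) c =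
  (fun n => fps_mul a c n - fps_mul b c n).
Proof.
by apply/funext => n; rewrite /fps_mul -sumrB; apply: eq_bigr => i _; rewrite mulrBl.
Qed.

Lemma fps_mulZl (k : A) a c : fps_mul (fun n => k * a n) c =
  (fun n => k * fps_mul a c n).
Proof.
by apply/funext => n; rewrite /fps_mul big_distrr; apply: eq_bigr => i _; rewrite -mulrA.
Qed.

(** Take the least [k] with [b k] nonzero. Once the coefficients of [a - c] below [n] are known to
    vanish, coefficient [n + k] of the product with [b] reduces to [(a n - c n) * b k]. Series such
    as sinh, with zero constant coefficient, are covered. *)
Lemma fps_mul_cancel a c b k : b k != 0 -> fps_mul a b = fps_mul c b -> a = c.
Proof.
move=> bk ab.
have exb : exists k, b k != 0 by exists k.
case: (ex_minnP exb) => {bk k exb} k bk kmin.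
suff H n : a n - c n = 0 by apply/funext => n; apply/eqP; rewrite -subr_eq0 H.
elim/ltn_ind: n => n IH.
have : fps_mul (fun n => a n - c n) b (n + k)%N = 0 by rewrite fps_mulBl ab subrr.
have nk : (n < (n + k).+1)%N by rewrite ltnS leq_addr.
rewrite /fps_mul (bigD1 (Ordinal nk))//= addKn big1.
  by rewrite addr0 => /eqP; rewrite mulf_eq0 (negPf bk) orbF => /eqP.
move=> i; rewrite -val_eqE /= => ni.
have [lt|gt|eq] := ltngtP i n; last by rewrite eq eqxx in ni.
  by rewrite IH ?mul0r.
have [->|bi] := eqVneq (b (n + k - i)%N) 0; first by rewrite mulr0.
have := kmin _ bi; have := ltn_ord i; lia.
Qed.

(** Long division by a series [b] with [b 0 = 0] and [b 1 = 1]: coefficient [m] of the quotient is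
    read off coefficient [m + 1] of [q * b = a]. The whole prefix is carried along because each
    coefficient uses all earlier ones. *)
Fixpoint fps_quo_seq a b n : seq A :=
  if n is m.+1 then
    let s := fps_quo_seq a b m in
    rcons s (a m.+1 - \sum_(i < m) s`_i * b (m.+1 - i)%N)
  else [::].

Lemma size_fps_quo_seq a b n : size (fps_quo_seq a b n) = n.
Proof. by elim: n => //= n IH; rewrite size_rcons IH. Qed.

Lemma nth_fps_quo_seq a b n m k : (k < n)%N -> (n <= m)%N ->
  (fps_quo_seq a b m)`_k = (fps_quo_seq a b n)`_k.
Proof.
move=> kn; elim: m => [|m IH]; first by rewrite leqn0 => /eqP n0; rewrite n0 in kn.
rewrite leq_eqVlt => /predU1P[->//|]; rewrite ltnS => nm.
by rewrite /= nth_rcons size_fps_quo_seq (leq_trans kn nm) IH.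
Qed.

(** Existence of the quotient, so that the [xget] in [fps_div] does not fall back on its default.
    The normalization [b 1 = 1] makes the division possible over a domain that is not a field. *)
Lemma fps_divP a b : a 0%N = 0 -> b 0%N = 0 -> b 1%N = 1 ->
  fps_mul (fps_div a b) b = a.
Proof.
move=> a0 b0 b1; rewrite /fps_div.
suff ex : [set q | fps_mul q b = a]%classic (fun n => (fps_quo_seq a b n.+1)`_n).
  exact: (xgetI _ ex).
apply/funext => -[|n].
  by rewrite /fps_mul big_ord_recl big_ord0 b0 a0 mulr0 addr0.
rewrite /fps_mul/= !big_ord_recr/= subnn b0 mulr0 addr0 subSnn b1 mulr1.
rewrite nth_rcons size_fps_quo_seq ltnn eqxx addrC.
set S1 := (X in _ - X + _); set S2 := (X in _ + X).
suff -> : S1 = S2 by rewrite subrK.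
apply: eq_bigr => i _.
by congr (_ * _); rewrite -(@nth_fps_quo_seq a b i.+1 n).
Qed.

Lemma fps_div_uniq a b q k : b k != 0 -> fps_mul q b = a -> fps_div a b = q.
Proof.
move=> bk qb; rewrite /fps_div; case: xgetP => [p _ /= pb|/(_ q)//].
by apply: (fps_mul_cancel bk); rewrite pb.
Qed.

(** Substitution of [k * t] for the variable [t]. *)
Definition fps_scale (k : A) a : nat -> A := fun n => k ^+ n * a n.

Lemma fps_scaleM k a b :
  fps_scale k (fps_mul a b) = fps_mul (fps_scale k a) (fps_scale k b).
Proof.
apply/funext => n; rewrite /fps_scale /fps_mul big_distrr; apply: eq_bigr => i _ /=.
rewrite -[in k ^+ n](@subnKC i n) ?leq_ord// exprD; ring.
Qed.

Lemma fps_scale_t k : fps_scale k (@fps_t A) = fun n => k * @fps_t A n.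
Proof.
by apply/funext => n; rewrite /fps_scale /fps_t; case: n => [|[|n]]; rewrite ?mulr0 ?expr1.
Qed.

Lemma fps_scale_exp k x : fps_scale k (@fps_exp A x) = fps_exp (k * x).
Proof. by apply/funext => n; rewrite /fps_scale /fps_exp exprMn mulrA. Qed.

Hypothesis unitA : forall n, (n.+1%:R : A) \is a GRing.unit.

Lemma unit_fact n : (n`!%:R : A) \is a GRing.unit.
Proof. by rewrite -(prednK (fact_gt0 n)). Qed.

Lemma fps_expD x y : fps_mul (@fps_exp A x) (fps_exp y) = fps_exp (x + y).
Proof.
apply/funext => n; rewrite /fps_mul /fps_exp addrC exprDn big_distrl/=.
apply: eq_bigr => i _.
have le : (i <= n)%N by rewrite leq_ord.
have /(congr1 (fun m => m%:R : A)) := bin_fact le; rewrite !natrM => e.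
apply: (mulrI (unit_fact n)); rewrite -{1}e -mulr_natr.
rewrite [RHS]mulrC divrK ?unit_fact//.
set u := (i`!%:R : A); set v := ((n-i)`!%:R : A).
have uu : u \is a GRing.unit by exact: unit_fact.
have uv : v \is a GRing.unit by exact: unit_fact.
(* The inverses become plain variables so that [ring] applies; [A] has no field structure. *)
have := divrr uu; have := divrr uv; move: (u^-1) (v^-1) => u' v' vv' uu'.
transitivity ('C(n, i)%:R * (x ^+ i * y ^+ (n - i)) * (u * u') * (v * v')); first by ring.
by rewrite uu' vv' !mulr1 -mulr_natl; ring.
Qed.

Lemma fps_exp0 : @fps_exp A 0 = fps_one.
Proof.
apply/funext => n; rewrite /fps_exp /fps_one expr0n; case: n => [|n]; last by rewrite mul0r.
by rewrite divr1.
Qed.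

Lemma fps_sinhE n : @fps_sinh A n = (odd n)%:R / n`!%:R.
Proof.
rewrite /fps_sinh /fps_exp expr1n -signr_odd; case: (odd n) => /=.
  by rewrite expr1 -mulrBl opprK mulrAC divrr ?mul1r// (unitA 1).
by rewrite expr0 subrr !mul0r.
Qed.

Lemma fps_sinh0 : @fps_sinh A 0%N = 0.
Proof. by rewrite fps_sinhE mul0r. Qed.

Lemma fps_sinh1 : @fps_sinh A 1%N = 1.
Proof. by rewrite fps_sinhE divr1. Qed.

Lemma fps_t_div_sinh : fps_mul (fps_div (@fps_t A) (@fps_sinh A)) (@fps_sinh A) = @fps_t A.
Proof. by apply: fps_divP; rewrite ?fps_sinh0 ?fps_sinh1. Qed.

Lemma fps_exp_nz (x : A) : @fps_exp A x 0%N != 0.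
Proof. by rewrite /fps_exp expr0 divr1 oner_eq0. Qed.

Lemma fps_sinh_nz : @fps_sinh A 1%N != 0.
Proof. by rewrite fps_sinh1 oner_eq0. Qed.

End FormalPowerSeries.

(** * Power series under ring morphisms *)

Section FormalMap.
Variables (A B : idomainType) (f : {rmorphism A -> B}).
Hypothesis unitA : forall n, (n.+1%:R : A) \is a GRing.unit.
Hypothesis unitB : forall n, (n.+1%:R : B) \is a GRing.unit.

Lemma map_fps_mul (a b : nat -> A) :
  f \o fps_mul a b = fps_mul (f \o a) (f \o b).
Proof.
by apply/funext => n; rewrite /fps_mul/= rmorph_sum; apply: eq_bigr => i _; rewrite rmorphM.
Qed.

Lemma map_fps_t : f \o @fps_t A = @fps_t B.
Proof. by apply/funext => n; rewrite /= rmorph_nat. Qed.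

Lemma map_fps_exp x : f \o @fps_exp A x = @fps_exp B (f x).
Proof.
by apply/funext => n; rewrite /= /fps_exp rmorphM rmorphV ?unit_fact// rmorph_nat rmorphXn.
Qed.

Lemma map_fps_sinh : f \o @fps_sinh A = @fps_sinh B.
Proof.
by apply/funext => n; rewrite /= !fps_sinhE// rmorphM rmorphV ?unit_fact// !rmorph_nat.
Qed.

(** By uniqueness of quotients. It shows that t / sinh t over [{poly R[i]}] has constant polynomials
    as coefficients, and complex ones that are real. *)
Lemma map_fps_t_div_sinh :
  f \o fps_div (@fps_t A) (@fps_sinh A) = fps_div (@fps_t B) (@fps_sinh B).
Proof.
symmetry; apply: (fps_div_uniq (fps_sinh_nz unitB)).
by rewrite -map_fps_sinh -map_fps_mul fps_t_div_sinh// map_fps_t.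
Qed.

End FormalMap.

(** * Bernoulli polynomials *)

Section BernoulliPolynomials.
Variable R : realType.
Local Notation C := R[i].
Local Notation P := (@Ppoly R).

Lemma unit_natC n : (n.+1%:R : C) \is a GRing.unit.
Proof. by rewrite unitfE pnatr_eq0. Qed.

Lemma unit_nat_polyC n : (n.+1%:R : {poly C}) \is a GRing.unit.
Proof. by rewrite -(rmorph_nat (@polyC C)); apply: rmorph_unit; exact: unit_natC. Qed.

Local Notation uP := unit_nat_polyC.
Local Notation X := ('X : {poly C}).

(** The series 2 sinh(c t), and 2 cosh(c t) for [fps_dcosh]; keeping the factor 2 avoids
    inverses. *)
Definition fps_dsinh (c : {poly C}) : nat -> {poly C} :=
  fun n => fps_exp c n - fps_exp (- c) n.

Definition fps_dcosh (c : {poly C}) : nat -> {poly C} :=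
  fun n => fps_exp c n + fps_exp (- c) n.

Lemma fps_dsinh_exp c d :
  fps_mul (fps_dsinh c) (fps_exp d) = fun n => fps_exp (c + d) n - fps_exp (d - c) n.
Proof. by rewrite /fps_dsinh fps_mulBl !fps_expD ?[- c + d]addrC//; exact: uP. Qed.

Lemma fps_dcosh_exp c d :
  fps_mul (fps_dcosh c) (fps_exp d) = fun n => fps_exp (c + d) n + fps_exp (d - c) n.
Proof. by rewrite /fps_dcosh fps_mulDl !fps_expD ?[- c + d]addrC//; exact: uP. Qed.

Lemma fps_dsinh_dcosh c : fps_mul (fps_dsinh c) (fps_dcosh c) = fps_dsinh (c + c).
Proof.
rewrite fps_mulC {1}/fps_dcosh fps_mulDl ![fps_mul (fps_exp _) _]fps_mulC !fps_dsinh_exp.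
by apply/funext => n; rewrite /fps_dsinh subrr opprD; ring.
Qed.

Lemma fps_dsinh1E : fps_dsinh 1 = fun n => 2%:R * @fps_sinh {poly C} n.
Proof.
by apply/funext => n; rewrite /fps_sinh mulrC divrK// (uP 1).
Qed.

Lemma fps_scale_dsinh k c : fps_scale k (fps_dsinh c) = fps_dsinh (k * c).
Proof.
apply/funext => n; rewrite /fps_dsinh.
have := congr1 (@^~ n) (fps_scale_exp k c); have := congr1 (@^~ n) (fps_scale_exp k (- c)).
by rewrite mulrN /fps_scale => <- <-; rewrite mulrBr.
Qed.

Lemma fps_dcosh_nz c : fps_dcosh c 0%N != 0.
Proof.
rewrite /fps_dcosh /fps_exp !expr0 divr1 -mulr2n.
by apply/eqP => e; move: (uP 1); rewrite e unitr0.
Qed.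

Definition Pcoef : nat -> {poly C} := fun n => P n / n`!%:R.

Let beta : nat -> {poly C} := fps_div (fps_mul (@fps_t {poly C}) (fps_exp 'X))
  (fun k => fps_exp 1 k - (k == 0%N)%:R).

Lemma betaP : fps_mul beta (fun k => fps_exp 1 k - (k == 0%N)%:R) =
  fps_mul (@fps_t {poly C}) (fps_exp 'X).
Proof.
apply: fps_divP.
- by rewrite /fps_mul big_ord_recl big_ord0 /fps_t /= mul0r addr0.
- by rewrite /fps_exp expr0 divr1 subrr.
- by rewrite /fps_exp expr1 divr1 subr0.
Qed.

(** The generating function of the P_n is that of the Bernoulli polynomials after x := (x + 1) / 2
    and t := 2 t. *)
Lemma PcoefE : Pcoef = fps_scale 2%:R
  ((comp_poly ((2%:R : C)^-1 *: ('X + 1)) : {poly C} -> {poly C}) \o beta).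
Proof.
apply/funext => n; rewrite /Pcoef /Ppoly /bernoulli_poly /fps_scale /=.
rewrite comp_polyZ -[fps_div _ _ n]/(beta n).
rewrite -!mul_polyC rmorphXn/= !rmorph_nat -mulrA; congr (_ * _).
by rewrite mulrC mulrA mulVr ?mul1r// unit_fact//; exact: uP.
Qed.

(** The substitution turns e^t - 1 into e^(2t) - 1 = e^t (e^t - e^(-t)) and e^(xt) into e^((x + 1)
    t); the common factor e^t cancels. *)
Lemma Pcoef_dsinh : fps_mul Pcoef (fps_dsinh 1) =
  fun n => 2%:R * fps_mul (@fps_t {poly C}) (fps_exp 'X) n.
Proof.
have /(congr1 (fun a => fps_scale 2%:R (comp_poly ((2%:R : C)^-1 *: ('X + 1)) \o a))) := betaP.
rewrite !map_fps_mul !fps_scaleM -PcoefE map_fps_t map_fps_exp; last exact: uP.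
rewrite fps_scale_t fps_scale_exp fps_mulZl /= comp_polyX.
have -> : 2%:R * ((2%:R : C)^-1 *: (X + 1)) = X + 1.
  by rewrite -mul_polyC mulrA -(rmorph_nat (@polyC C)) -rmorphM divff ?pnatr_eq0// rmorph1 mul1r.
set e := fps_scale _ _.
have -> : e = fps_mul (fps_dsinh 1) (fps_exp 1).
  rewrite /e fps_dsinh_exp subrr; apply/funext => n.
  have := congr1 (@^~ n) (map_fps_exp (comp_poly ((2%:R : C)^-1 *: ('X + 1))) uP 1).
  rewrite /fps_scale /= rmorphB /= => ->; rewrite rmorph1 rmorph_nat mulrBr.
  rewrite -[_ * fps_exp 1 n]/(fps_scale 2%:R (fps_exp 1) n) fps_scale_exp mulr1.
  rewrite fps_exp0; congr (_ - _); rewrite /fps_one.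
  by case: n => [|n]; rewrite ?mulr1 ?mulr0.
move=> H; apply: (fps_mul_cancel (fps_exp_nz 1)).
rewrite -fps_mulA H fps_mulZl -fps_mulA fps_expD//; exact: uP.
Qed.

Theorem Pcoef_gf :
  Pcoef = fps_mul (fps_div (@fps_t {poly C}) (@fps_sinh {poly C})) (fps_exp 'X).
Proof.
apply: (fps_mul_cancel (fps_sinh_nz uP)).
rewrite -fps_mulA [fps_mul (fps_exp _) _]fps_mulC fps_mulA fps_t_div_sinh; last exact: uP.
have := Pcoef_dsinh; rewrite fps_dsinh1E fps_mulC fps_mulZl fps_mulC => H.
apply/funext => n; have := congr1 (@^~ n) H => /=; exact: (mulrI (uP 1)).
Qed.

Lemma Pcoef_comp (c : {poly C}) :
  fps_mul ((comp_poly c : {poly C} -> {poly C}) \o Pcoef) (fps_dsinh 1) =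
  fun n => 2%:R * fps_mul (@fps_t {poly C}) (fps_exp c) n.
Proof.
have /(congr1 (fun a => comp_poly c \o a)) := Pcoef_dsinh.
rewrite map_fps_mul.
have -> : comp_poly c \o fps_dsinh 1 = fps_dsinh 1.
  rewrite fps_dsinh1E; apply/funext => n; rewrite /= rmorphM rmorph_nat.
  by have /= -> := congr1 (@^~ n) (map_fps_sinh (comp_poly c) uP uP).
move=> ->; apply/funext => n; rewrite /= rmorphM rmorph_nat; congr (_ * _).
have /= -> := congr1 (@^~ n) (map_fps_mul (comp_poly c) (@fps_t {poly C}) (fps_exp 'X)).
rewrite map_fps_t map_fps_exp; last exact: uP.
by rewrite /= comp_polyX.
Qed.

Let half : {poly C} := 2%:R^-1.

(** Multiply both sides by 2 sinh(t/2) 2 cosh(t/2) = 2 sinh t. The left side becomes 2 t (e^((x + 1)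
    t/2) + e^((x - 1) t/2)) = 2 t e^(xt/2) 2 cosh(t/2). On the right, the factor 2 sinh(t/2) is
    absorbed by the generating function at t/2, which leaves the same series. *)
Lemma Pcoef_avg n :
  (Pcoef n \Po (half * ('X + 1))) + (Pcoef n \Po (half * ('X - 1))) =
  2%:R * (half ^+ n * Pcoef n).
Proof.
have h2 : half + half = 1 by rewrite -mulr2n -mulr_natr mulVr// (uP 1).
have h2' : half * 2%:R = 1 by rewrite mulVr// (uP 1).
suff : (fun n => (Pcoef n \Po (half * ('X + 1))) + (Pcoef n \Po (half * ('X - 1)))) =
  fun n => 2%:R * fps_scale half Pcoef n by move/(congr1 (@^~ n)).
have nz : fps_dsinh half 1%N != 0.
  rewrite /fps_dsinh /fps_exp !expr1 !divr1 opprK h2; exact: oner_neq0.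
apply: (fps_mul_cancel nz); apply: (fps_mul_cancel (fps_dcosh_nz half)).
rewrite -[in LHS]fps_mulA fps_dsinh_dcosh h2 fps_mulDl !fps_mulZl.
rewrite -[fun n1 => Pcoef n1 \Po half * ('X + 1)]/(comp_poly (half * ('X + 1)) \o Pcoef).
rewrite -[fun n1 => Pcoef n1 \Po half * ('X - 1)]/(comp_poly (half * ('X - 1)) \o Pcoef).
rewrite !Pcoef_comp.
have -> : fps_mul (fps_scale half Pcoef) (fps_dsinh half) =
    fps_mul (@fps_t {poly C}) (fps_exp (half * 'X)).
  rewrite -[in fps_dsinh half](mulr1 half) -fps_scale_dsinh -fps_scaleM Pcoef_dsinh.
  apply/funext => m; rewrite -fps_scale_exp.
  have := congr1 (@^~ m) (fps_scaleM half (@fps_t {poly C}) (fps_exp 'X)).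
  rewrite fps_scale_t fps_mulZl /fps_scale => /(congr1 (fun u => 2%:R * u)).
  rewrite [2%:R * (half * _)]mulrA [2%:R * half]mulrC h2' mul1r => <-.
  by rewrite mulrCA.
rewrite -fps_mulA [fps_mul (fps_exp _) _]fps_mulC fps_dcosh_exp.
apply/funext => m; rewrite -mulrDr; congr (_ * _).
have := congr1 (@^~ m) (fps_mulDl (fps_exp (half * ('X + 1))) (fps_exp (half * ('X - 1))) (@fps_t {poly C})).
rewrite /= ![fps_mul _ (@fps_t _)]fps_mulC => <-.
by rewrite mulrDr mulrBr mulr1 [half + _]addrC.
Qed.

Lemma PpolyE n : P n = n`!%:R * Pcoef n.
Proof. by rewrite /Pcoef mulrC divrK// unit_fact//; exact: uP. Qed.

Lemma Ppoly_avg n (x : C) :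
  ((P n).[(x + 1) / 2%:R] + (P n).[(x - 1) / 2%:R]) / 2%:R = (2%:R ^+ n)^-1 * (P n).[x].
Proof.
have n2 : 2%:R != 0 :> C by rewrite pnatr_eq0.
have hE : half = (2%:R^-1 : C)%:P by rewrite /half -(rmorph_nat (@polyC C)) rmorphV ?unitfE.
have PE y : (P n).[y] = n`!%:R * (Pcoef n).[y].
  by rewrite PpolyE hornerM -(rmorph_nat (@polyC C)) hornerC.
have e : 2%:R * (half ^+ n * Pcoef n) = (2%:R * 2%:R^-1 ^+ n : C)%:P * Pcoef n.
  by rewrite hE rmorphM rmorph_nat rmorphXn/= mulrA.
have := congr1 (fun p => p.[x]) (Pcoef_avg n).
rewrite e hornerD !horner_comp [in RHS]hornerM hornerC hE.
have -> : ((2%:R^-1 : C)%:P * ('X + 1)).[x] = (x + 1) / 2%:R by rewrite !hornerE mulrC.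
have -> : ((2%:R^-1 : C)%:P * ('X - 1)).[x] = (x - 1) / 2%:R by rewrite !hornerE mulrC.
rewrite !PE -mulrDr => ->.
by rewrite exprVn -!mulrA [_ * 2%:R^-1]mulrC; field; rewrite ?expf_neq0.
Qed.

Let s : nat -> C := fps_div (@fps_t C) (@fps_sinh C).

Lemma Pcoef_sum n :
  Pcoef n = \sum_(i < n.+1) (s i / (n - i)`!%:R) *: 'X^(n - i).
Proof.
rewrite Pcoef_gf -(map_fps_t_div_sinh (@polyC C) unit_natC uP) /fps_mul.
apply: eq_bigr => i _; rewrite /= -mul_polyC /fps_exp rmorphM rmorphV ?unit_fact//; last exact: unit_natC.
by rewrite rmorph_nat mulrA mulrAC.
Qed.

(** The quotient n! / (n - i)! is written as the falling factorial, the coefficient of the i-th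
    derivative of x^n, so that the formulas for D / sinh D and for the derivative of P_n can be read
    off. *)
Lemma Ppoly_sum n :
  P n = \sum_(i < n.+1) (s i * (n ^_ i)%:R) *: 'X^(n - i).
Proof.
rewrite PpolyE Pcoef_sum mulr_sumr; apply: eq_bigr => i _.
rewrite -(rmorph_nat (@polyC C)) mul_polyC scalerA; congr (_ *: _).
rewrite mulrCA; congr (_ * _).
by rewrite -(@ffact_fact n i) ?leq_ord// natrM mulfK// pnatr_eq0 -lt0n fact_gt0.
Qed.

Theorem Ppoly_D_over_sinhD n : P n = D_over_sinhD 'X^n.
Proof.
rewrite Ppoly_sum /D_over_sinhD size_polyXn; apply: eq_bigr => i _.
by rewrite derivnXn -scalerA scaler_nat.
Qed.

Theorem deriv_Ppoly0 : (P 0%N)^`() = 0.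
Proof. by rewrite Ppoly_sum big_ord_recl big_ord0 addr0 derivZ derivC scaler0. Qed.

Theorem deriv_Ppoly n : (P n.+1)^`() = n.+1%:R *: P n.
Proof.
rewrite !Ppoly_sum big_ord_recr/= subnn derivD derivZ derivC scaler0 addr0.
rewrite raddf_sum scaler_sumr; apply: eq_bigr => i _.
rewrite /= derivZ derivXn subSn ?leq_ord//= -[_ *+ (n - i).+1]scaler_nat !scalerA.
congr (_ *: _); rewrite [RHS]mulrCA -mulrA; congr (_ * _); rewrite -!natrM; congr (_%:R).
apply/eqP; rewrite -(eqn_pmul2r (fact_gt0 (n - i))) -!mulnA -factS -subSn ?leq_ord//.
by rewrite !ffact_fact ?leqW ?leq_ord.
Qed.

(** Compare the coefficients of t^(N + 1) in (sum of P_n t^n / n!) sinh t = t e^(xt). *)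
Theorem Xn_Ppoly N : ~~ odd N ->
  'X^N = \sum_(j < N./2.+1) ('C(N, 2 * j)%:R / (2 * j + 1)%:R : C) *: P (N - 2 * j).
Proof.
move=> oN.
have /(congr1 (@^~ N.+1)) : fps_mul Pcoef (@fps_sinh {poly C}) = fps_mul (@fps_t {poly C}) (fps_exp 'X).
  rewrite Pcoef_gf -fps_mulA [fps_mul (fps_exp _) _]fps_mulC fps_mulA fps_t_div_sinh//; exact: uP.
rewrite [in RHS]/fps_mul big_ord_recl /fps_t mul0r add0r big_ord_recl /= mul1r.
rewrite big1 ?addr0; last by move=> i _; rewrite mul0r.
rewrite subSS subn0 => /(congr1 (fun u => u * N`!%:R)).
rewrite [RHS]divrK ?unit_fact//; last exact: uP.
move=> <-; rewrite fps_mulC /fps_mul mulr_suml big_ord_recl fps_sinh0 ?mul0r ?add0r; last exact: uP.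
have N2 : N = N./2.*2 by rewrite -[LHS]odd_double_half (negbTE oN).
(* After [big_ord_recl] the index [i] carries coefficient [i + 1] of sinh, so it is the odd [i] that
   vanish. *)
rewrite (bigID (fun i : 'I_N.+1 => odd i)) /= [X in X + _]big1 ?add0r.
  rewrite (eq_bigl (fun i : 'I_N.+1 => ~~ odd i))//.
  pose h (j : 'I_N./2.+1) : 'I_N.+1 := inord (2 * j).
  have hE (j : 'I_N./2.+1) : h j = (2 * j)%N :> nat.
    by rewrite inordK//; have := ltn_ord j; move: N2; lia.
  rewrite (reindex h) /=; last first.
    exists (fun i : 'I_N.+1 => inord i./2) => [j _|i oi]; apply: val_inj => /=.
      by rewrite hE mul2n doubleK inordK.
    rewrite inE in oi; rewrite hE inordK; last first.
      by rewrite ltnS half_leq// leq_ord.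
    by rewrite mul2n -[RHS]odd_double_half (negbTE oi).
  apply: eq_big => [j|j _]; first by rewrite hE mul2n odd_double.
  have jN : (2 * j <= N)%N by have := ltn_ord j; move: N2; lia.
  rewrite /bump /= hE add1n subSS fps_sinhE; last exact: uP.
  have -> : odd (2 * j).+1 by rewrite mul2n /= odd_double.
  rewrite factS natrM.
  rewrite PpolyE -!mul_polyC !rmorphM rmorphV/= ?addn1; last exact: unit_natC.
  rewrite !rmorph_nat.
  have /(congr1 (fun m => m%:R : {poly C})) := bin_fact jN; rewrite !natrM => <-.
  have uf m : (m`!%:R : {poly C}) \is a GRing.unit by exact: unit_fact uP _.
  rewrite invrM//; last exact: uP.
  have := mulVr (uf (2 * j)%N).
  move: ((2 * j)`!%:R^-1) ((2 * j).+1%:R^-1) => u v e.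
  by rewrite mul1r;
    transitivity ('C(N, 2 * j)%:R * v * ((N - 2 * j)`!%:R * Pcoef (N - 2 * j)) * (u * (2*j)`!%:R));
    [ring|rewrite e mulr1].
by move=> i oi; rewrite fps_sinhE ?/bump /= ?oi ?mul0r//; exact: uP.
Qed.

End BernoulliPolynomials.

(** * Series of complex numbers *)

Section ComplexSeries.
Variable R : realType.
Local Notation C := R[i].
Local Notation normc := (@Normc.normc R).
Local Notation Re := (@complex.Re R).
Local Notation Im := (@complex.Im R).
Implicit Types (u v : nat -> C) (z : C).

Lemma normc_ge0 z : 0 <= normc z.
Proof. by case: z => a b; exact: sqrtr_ge0. Qed.

Lemma norm_normc z : `|z| = (normc z)%:C.
Proof. by case: z. Qed.

Lemma normc_real (a : R) : normc a%:C = `|a|.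
Proof. by rewrite /= expr0n /= addr0 sqrtr_sqr. Qed.

Lemma normr_Re z : `|Re z| <= normc z.
Proof. by rewrite -lecR -norm_normc normc_ge_Re. Qed.

Lemma normr_Im z : `|Im z| <= normc z.
Proof.
case: z => a b /=; rewrite -sqrtr_sqr ler_wsqrtr// lerDr sqr_ge0.
by [].
Qed.

Lemma normc_le z : normc z <= `|Re z| + `|Im z|.
Proof.
case: z => a b /=; rewrite -[leRHS]ger0_norm ?addr_ge0// -[leRHS]sqrtr_sqr.
rewrite ler_wsqrtr// sqrrD !real_normK ?num_real//.
by rewrite addrAC lerDl mulrn_wge0// mulr_ge0.
Qed.

Lemma normcX z n : normc (z ^+ n) = normc z ^+ n.
Proof.
by elim: n => [|n IH]; rewrite ?expr0 ?Normc.normc1// !exprS Normc.normcM IH.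
Qed.

Lemma normc_sum (I : Type) (r : seq I) (P : pred I) (F : I -> C) :
  normc (\sum_(i <- r | P i) F i) <= \sum_(i <- r | P i) normc (F i).
Proof.
elim/big_ind2 : _ => [|x a y b xa yb|//]; first by rewrite Normc.normc0.
by rewrite (le_trans (le_normcD _ _))// lerD.
Qed.

Lemma Re_sum (I : Type) (r : seq I) (P : pred I) (F : I -> C) :
  Re (\sum_(i <- r | P i) F i) = \sum_(i <- r | P i) Re (F i).
Proof. by apply: (big_morph Re (id1 := 0) (op1 := +%R)) => // -[a b] [c d]. Qed.

Lemma Im_sum (I : Type) (r : seq I) (P : pred I) (F : I -> C) :
  Im (\sum_(i <- r | P i) F i) = \sum_(i <- r | P i) Im (F i).
Proof. by apply: (big_morph Im (id1 := 0) (op1 := +%R)) => // -[a b] [c d]. Qed.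

Lemma normc_lt1 (lam : C) : `|lam| < 1 -> normc lam < 1.
Proof. by rewrite norm_normc -[1]/(1%:C) ltcR. Qed.

Lemma ccvgP u z : ((u : nat -> C^o) @ \oo --> (z : C^o)) <->
  ((Re \o u) @ \oo --> Re z /\ (Im \o u) @ \oo --> Im z).
Proof.
split=> [/cvgrPdist_lt uz|[/cvgrPdist_lt uzR /cvgrPdist_lt uzI]].
  split; apply/cvgrPdist_lt => e e0.
    have := uz e%:C; rewrite ltcR => /(_ e0); apply: filterS => n /=.
    rewrite norm_normc ltcR; apply: le_lt_trans.
    by apply: le_trans (normr_Re _); case: z {uz} => a b; case: (u n).
  have := uz e%:C; rewrite ltcR => /(_ e0); apply: filterS => n /=.
  rewrite norm_normc ltcR; apply: le_lt_trans.
  by apply: le_trans (normr_Im _); case: z {uz} => a b; case: (u n).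
(* In the order of [R[i]], [0 < e] forces [e] to be real. *)
apply/cvgrPdist_lt => e; rewrite ltcE /= => /andP[/eqP Ie Re0].
have -> : e = (Re e)%:C by case: e Ie Re0 => a b /= ->.
have e20 : 0 < Re e / 2 by rewrite divr_gt0.
have := uzI _ e20; have := uzR _ e20; apply: filterS2 => n /= h1 h2.
rewrite norm_normc ltcR (le_lt_trans (normc_le _))// [ltRHS]splitr ltrD//.
  by move: h1; case: z {uzR uzI h2} => a b; case: (u n).
by move: h2; case: z {uzR uzI h1} => a b; case: (u n).
Qed.

Lemma csum_unique u z : (series (u : nat -> C^o) @ \oo --> (z : C^o)) -> csum u = z.
Proof. move=> h; rewrite /csum /lim /lim_in; case: xgetP => [y _ /= hy|/(_ z)/(_ h)//].
exact: (@cvg_unique _ (@norm_hausdorff _ C^o) _ _ _ _ hy h).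
Qed.

Definition abs_summable u := cvgn (series (fun n => normc (u n))).

Lemma abs_summable_le u (v : nat -> R) :
  (forall n, normc (u n) <= v n) -> cvgn (series v) -> abs_summable u.
Proof.
move=> uv cv; apply: (series_le_cvg _ _ uv cv) => n; first exact: normc_ge0.
by rewrite (le_trans _ (uv n))// normc_ge0.
Qed.

Lemma series_Re u : Re \o series (u : nat -> C^o) = series (Re \o u).
Proof. by apply/funext => n; rewrite /series/= Re_sum. Qed.

Lemma series_Im u : Im \o series (u : nat -> C^o) = series (Im \o u).
Proof. by apply/funext => n; rewrite /series/= Im_sum. Qed.

Lemma abs_summable_Re u : abs_summable u -> cvgn (series (Re \o u)).
Proof.
move=> su; apply: normed_cvg; apply: (series_le_cvg _ _ _ su) => n //=.
  exact: normc_ge0.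
exact: normr_Re.
Qed.

Lemma abs_summable_Im u : abs_summable u -> cvgn (series (Im \o u)).
Proof.
move=> su; apply: normed_cvg; apply: (series_le_cvg _ _ _ su) => n //=.
  exact: normc_ge0.
exact: normr_Im.
Qed.

Lemma csumE u : abs_summable u ->
  csum u = limn (series (Re \o u)) +i* limn (series (Im \o u)).
Proof.
move=> su; apply: csum_unique; apply/ccvgP; split => /=.
  by rewrite series_Re; exact: abs_summable_Re.
by rewrite series_Im; exact: abs_summable_Im.
Qed.

Lemma cvg_csum u : abs_summable u -> series (u : nat -> C^o) @ \oo --> (csum u : C^o).
Proof.
move=> su; apply/ccvgP; rewrite csumE//=; split.
  by rewrite series_Re; exact: abs_summable_Re.
by rewrite series_Im; exact: abs_summable_Im.
Qed.

Lemma abs_summableD u v : abs_summable u -> abs_summable v ->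
  abs_summable (fun n => u n + v n).
Proof.
move=> su sv; apply: (abs_summable_le (v := fun n => normc (u n) + normc (v n))).
  by move=> n; exact: le_normcD.
exact: is_cvg_seriesD.
Qed.

Lemma abs_summableZ z u : abs_summable u -> abs_summable (fun n => z * u n).
Proof.
move=> su; apply: (abs_summable_le (v := fun n => normc z * normc (u n))).
  by move=> n; rewrite Normc.normcM.
exact: is_cvg_seriesZ.
Qed.

Lemma csumD u v : abs_summable u -> abs_summable v ->
  csum (fun n => u n + v n) = csum u + csum v.
Proof.
move=> su sv; apply: csum_unique.
rewrite -[fun n => u n + v n]/((u : nat -> C^o) + v) seriesD.
exact: cvgD (cvg_csum su) (cvg_csum sv).
Qed.

Lemma csumZ z u : abs_summable u -> csum (fun n => z * u n) = z * csum u.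
Proof.
move=> su; apply: csum_unique.
rewrite -[fun n => z * u n]/(z *: (u : nat -> C^o)) seriesZ.
exact: cvgZr (cvg_csum su).
Qed.

Lemma abs_summableS u : abs_summable u -> abs_summable (fun n => u n.+1).
Proof.
rewrite /abs_summable => su.
rewrite [X in cvgn X](_ : _ = fun n => series (fun n => normc (u n)) n.+1 - normc (u 0%N)).
  apply: is_cvgB; last exact: is_cvg_cst.
  by apply/cvg_ex; exists (limn (series (fun n => normc (u n)))); rewrite -cvg_shiftS in su *.
by apply/funext => n; rewrite /series/= [in RHS]big_nat_recl// addrC addKr.
Qed.

Lemma csumS u : abs_summable u -> csum u = u 0%N + csum (fun n => u n.+1).
Proof.
move=> su; apply: csum_unique.
rewrite -cvg_shiftS.
rewrite [X in X @ _](_ : _ = fun n => (u 0%N : C^o) + series (fun n => u n.+1 : C^o) n).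
  by apply: cvgD; [exact: cvg_cst|apply: cvg_csum; exact: abs_summableS].
by apply/funext => n; rewrite seriesEnat /= big_nat_recl.
Qed.

Lemma normc_csum u : abs_summable u ->
  normc (csum u) <= limn (series (fun n => normc (u n))).
Proof.
move=> su; rewrite -lecR -norm_normc.
have /ccvgP[/= h1 _] : (fun n => `|series (u : nat -> C^o) n| : C^o) @ \oo --> (`|csum u| : C^o).
  by apply: cvg_norm; exact: cvg_csum.
rewrite norm_normc lecR; apply: (ler_cvg_to h1 su).
by near=> n; exact: normc_sum.
Unshelve. all: by end_near. Qed.

End ComplexSeries.

(** * Cauchy products of absolutely convergent series *)

Section CauchyProduct.

(** The partial sum of the product runs over the triangle i + j < N, here summed by rows. *)
Lemma series_fps_mul (A : idomainType) (a b : nat -> A) N :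
  series (fps_mul a b) N = \sum_(0 <= i < N) a i * series b (N - i)%N.
Proof.
elim: N => [|N IH]; first by rewrite /series/= !big_geq.
rewrite seriesSr IH big_nat_recr//= subSnn.
under [in RHS]eq_big_nat => i /andP[_ iN] do rewrite subSn ?(ltnW iN)// seriesSr mulrDr.
rewrite big_split -addrA /=; congr (_ + _).
rewrite /fps_mul big_ord_recr /= subnn big_mkord; congr (_ + _ * _).
by rewrite /series/= big_nat1.
Qed.

Variable R : realType.
Local Notation C := R[i].
Local Notation normc := (@Normc.normc R).
Implicit Types a b : nat -> C.

(** The triangle of side n lies in the square of side n, which lies in the triangle of side 2 n. The
    second conclusion, on square minus triangle, is the error term that dominates the complex
    case. *)
Lemma cauchy_nonneg (a b : nat -> R) :
  (forall n, 0 <= a n) -> (forall n, 0 <= b n) ->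
  cvgn (series a) -> cvgn (series b) ->
  cvgn (series (fps_mul a b)) /\
  series a n * series b n - series (fps_mul a b) n @[n --> \oo] --> (0 : R).
Proof.
move=> a0 b0 ca cb.
have c0 n : 0 <= fps_mul a b n by apply: sumr_ge0 => i _; exact: mulr_ge0.
have ndb := nondecreasing_series (fun n _ _ => b0 n).
have nda := nondecreasing_series (fun n _ _ => a0 n).
have ndc := nondecreasing_series (fun n _ _ => c0 n).
have sb0 n : 0 <= series b n by apply: sumr_ge0.
have le1 n : series (fps_mul a b) n <= series a n * series b n.
  rewrite series_fps_mul /series/= mulr_suml; apply: ler_sum => i _.
  by rewrite ler_wpM2l//; apply: ndb; exact: leq_subr.
have le2 n : series a n * series b n <= series (fps_mul a b) n.*2.
  rewrite series_fps_mul /series/= mulr_suml -addnn.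
  rewrite (@big_cat_nat _ _ _ n 0 (n + n))//= ?leq_addr//.
  apply: ler_wpDr; first by apply: sumr_ge0 => i _; rewrite mulr_ge0// sumr_ge0.
  apply: ler_sum_nat => i /andP[_ iN].
  rewrite ler_wpM2l//; apply: ndb; lia.
have cab : series a n * series b n @[n --> \oo] --> limn (series a) * limn (series b).
  exact: cvgM.
have cc : cvgn (series (fps_mul a b)).
  apply: nondecreasing_is_cvgn; first exact: ndc.
  exists (limn (series a) * limn (series b)) => _ [n _ <-].
  rewrite (le_trans (le1 n))// ler_pM//; first exact: sumr_ge0.
    by apply: nondecreasing_cvgn_le => //; exact: nda.
  by apply: nondecreasing_cvgn_le => //; exact: ndb.
split=> //.
have c2 : series (fps_mul a b) n.*2 @[n --> \oo] --> limn (series (fps_mul a b)).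
  apply: (cvg_comp _ _ _ cc).
  by move=> A [M _ MA]; exists M => // n /= Mn; apply: MA => /=; rewrite -addnn; lia.
have e : limn (series a) * limn (series b) = limn (series (fps_mul a b)).
  apply: (cvg_unique (@Rhausdorff R) cab).
  by apply: (squeeze_cvgr _ cc c2); near=> n; rewrite le1 le2.
by rewrite -(subrr (limn (series (fps_mul a b)))) -{1}e; exact: cvgB.
Unshelve. all: by end_near. Qed.

Lemma normc_fps_mul a b n :
  normc (fps_mul a b n) <= fps_mul (fun n => normc (a n)) (fun n => normc (b n)) n.
Proof.
rewrite (le_trans (normc_sum _ _ _))//; apply: ler_sum => i _.
by rewrite Normc.normcM.
Qed.

Lemma abs_summable_fps_mul a b : abs_summable a -> abs_summable b ->
  abs_summable (fps_mul a b).
Proof.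
move=> sa sb; have [cc _] := cauchy_nonneg (fun n => normc_ge0 (a n)) (fun n => normc_ge0 (b n)) sa sb.
exact: abs_summable_le (normc_fps_mul a b) cc.
Qed.

(** Square minus triangle is bounded, row by row, by the same difference for the moduli, which tends
    to 0 by [cauchy_nonneg]. *)
Theorem csum_fps_mul a b : abs_summable a -> abs_summable b ->
  csum (fps_mul a b) = csum a * csum b.
Proof.
move=> sa sb; apply: csum_unique.
have [_ d0] := cauchy_nonneg (fun n => normc_ge0 (a n)) (fun n => normc_ge0 (b n)) sa sb.
have cab := cvgM (cvg_csum sa) (cvg_csum sb).
rewrite -[X in _ --> X](subr0 (csum a * csum b)).
rewrite [X in X @ _](_ : _ = (fun n => (series (a : nat -> C^o) n * series (b : nat -> C^o) n : C^o)
   - (series (a : nat -> C^o) n * series (b : nat -> C^o) n - series (fps_mul a b : nat -> C^o) n))); last first.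
  by apply/funext => n /=; rewrite opprB addrC subrK.
apply: cvgB; first exact: cab.
apply/cvgrPdist_lt => e; rewrite ltcE /= => /andP[/eqP Ie Re0].
have -> : e = (complex.Re e)%:C by case: e Ie Re0 => x y /= ->.
have /cvgrPdist_lt/(_ _ Re0) := d0; apply: filterS => n.
rewrite !sub0r !normrN norm_normc ltcR; apply: le_lt_trans.
apply: le_trans (ler_norm _).
rewrite !series_fps_mul /series/= !mulr_suml -!sumrB.
rewrite (le_trans (normc_sum _ _ _))//; apply: ler_sum => i _.
rewrite -!mulrBr Normc.normcM ler_wpM2l ?normc_ge0//.
rewrite !(sub_series_geq _ (leq_subr i n)).
exact: normc_sum.
Qed.

End CauchyProduct.

(** * The radius of convergence of t / sinh t *)

Section PiBound.
Variable R : realType.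

Lemma cos_coeff'_signr (x : R) n : cos_coeff' x n = (-1) ^+ n * (x ^+ (n.*2) / (n.*2)`!%:R).
Proof. by rewrite /cos_coeff' -exprnP mulrA. Qed.

Lemma sin_coeff'_signr (x : R) n : sin_coeff' x n = (-1) ^+ n * (x ^+ (n.*2.+1) / (n.*2.+1)`!%:R).
Proof. by rewrite /sin_coeff' -exprnP mulrA. Qed.

(** The value 8 / 5 is slightly above pi / 2. Three terms of the cosine series already give about
    -0.007, and the remaining terms, grouped in pairs, are negative. *)
Lemma cos_lt0 : cos (8 / 5 : R) < 0.
Proof.
set x : R := 8 / 5.
rewrite -(opprK (cos _)) oppr_lt0; have /cvgN h := @cvg_cos_coeff' R x.
rewrite -(cvg_lim (@Rhausdorff R) h).
apply: (@lt_trans _ _ (\sum_(0 <= i < 3) - cos_coeff' x i)).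
  rewrite !big_nat_recr//= big_nil !cos_coeff'_signr /x !factS fact0 /=.
  by rewrite !exprS !expr0; lra.
rewrite -seriesN lt_sum_lim_series //.
  by move/cvgP in h; by rewrite seriesN.
(* The pair of terms [m], [m + 1] with [m] odd: their ratio in modulus is x^2 / ((2m + 1)(2m + 2)),
   at most (64 / 25) / 8 < 1. *)
move=> d; set m := (3 + d.*2)%N.
have -> : (3 + d.*2.+1 = m.+1)%N by rewrite addnS.
have om : odd m by rewrite /m oddD odd_double.
have m3 : (3 <= m)%N by rewrite leq_addr.
move: m om m3 => m om m3.
rewrite -[X in 0 < X](_ : - (cos_coeff' x m + cos_coeff' x m.+1) = _); last by rewrite opprD.
rewrite oppr_gt0 !cos_coeff'_signr exprS.
have -> : (-1) ^+ m = -1 :> R by rewrite -signr_odd om.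
rewrite doubleS !factS !natrM !exprS !invfM.
set y := x ^+ m.*2; set f := (m.*2)`!%:R^-1.
have y0 : 0 < y by rewrite exprn_gt0// /x; lra.
have f0 : 0 < f by rewrite invr_gt0 ltr0n fact_gt0.
have m1 : 1 <= m.*2.+1%:R :> R by rewrite ler1n.
have m2 : 8 <= m.*2.+2%:R :> R by rewrite ler_nat; lia.
have q1 : m.*2.+1%:R^-1 <= 1 :> R by rewrite invf_le1 ?(lt_le_trans _ m1).
have q2 : m.*2.+2%:R^-1 <= 8^-1 :> R by rewrite lef_pV2 ?posrE ?(lt_le_trans _ m2).
have q3 : 0 <= m.*2.+1%:R^-1 :> R by rewrite invr_ge0.
have q4 : 0 <= m.*2.+2%:R^-1 :> R by rewrite invr_ge0.
have yf : 0 < y * f by exact: mulr_gt0.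
set p := m.*2.+1%:R^-1 in q1 q3 *; set q := m.*2.+2%:R^-1 in q2 q4 *.
have pq : p * q <= 8^-1 by rewrite (le_trans _ q2)// ler_piMl.
rewrite /x; nra.
Qed.

(** Cosine is positive on (-pi/2, pi/2), so 8 / 5 cannot lie there. *)
Lemma pi_le : 5 * pi <= 16 :> R.
Proof.
rewrite leNgt; apply/negP => h; have := cos_lt0; apply/negP; rewrite -leNgt ltW//.
by apply: cos_gt0_pihalf; have := @pi_gt0 R; lra.
Qed.

Lemma pi_sqr_le : 25 * pi ^+ 2 <= 256 :> R.
Proof. by have := pi_le; have := @pi_gt0 R => p0 p1; nra. Qed.

End PiBound.

(* The bounds below are those of u_k = pi ^ (2k) / (2k + 1)!, whose alternating
   sum is sin pi / pi = 0. *)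
Section AlternatingTails.
Variables (R : realType) (u : nat -> R).
Let T (m : nat) : R := \sum_(0 <= k < m.+1) (-1) ^+ k * u k.
Hypothesis u_ge0 : forall k, 0 <= u k.
Hypothesis u0 : u 0%N = 1.
Hypothesis u1 : `|1 - u 1%N| <= 53 / 75.
Hypothesis u3 : u 3%N <= 3 / 14.
Hypothesis u_ratio : forall k, u (3 + k)%N.+1 <= u (3 + k)%N * 7^-1.
Hypothesis T_cvg0 : T @ \oo --> (0 : R).

Let u3j j : u (3 + j)%N <= u 3%N * 7^-1 ^+ j.
Proof.
elim: j => [|j IH]; first by rewrite addn0 mulr1.
by rewrite addnS (le_trans (u_ratio j))// exprSr mulrA ler_wpM2r.
Qed.

(** Finite geometric sum with ratio 1 / 7, where 7 / 6 = 1 / (1 - 1 / 7); the factor in [M] makes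
    the induction close. *)
Let T_tail m M : `|T (m.+2) - T (m.+2 + M)%N| <= (7 / 6) * u 3%N * 7^-1 ^+ m * (1 - 7^-1 ^+ M).
Proof.
elim: M => [|M IH]; first by rewrite addn0 subrr normr0 expr0 subrr mulr0.
rewrite addnS.
have -> : T (m.+2) - T (m.+2 + M)%N.+1 =
    (T (m.+2) - T (m.+2 + M)%N) - (-1) ^+ (m.+2 + M)%N.+1 * u (m.+2 + M)%N.+1.
  by rewrite {2}/T big_nat_recr//= -/(T _) opprD addrA.
rewrite (le_trans (ler_normB _ _))// normrM normr_sign mul1r [`|u _|]ger0_norm//.
have h : u (m.+2 + M)%N.+1 <= u 3%N * 7^-1 ^+ (m + M).
  by rewrite -[(m.+2 + M)%N.+1]/(3 + (m + M))%N; exact: u3j.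
apply: le_trans (lerD IH h) _.
rewrite exprD exprS; set v := _ ^+ m; set w := _ ^+ M.
by rewrite le_eqVlt; apply/orP; left; apply/eqP; field.
Qed.

(** As the full sum is 0, a partial sum is minus its tail: let [M] grow in [T_tail]. *)
Let T_bound m : `|T m.+2| <= (7 / 6) * u 3%N * 7^-1 ^+ m.
Proof.
have c : (fun M => `|T m.+2 - T (m.+2 + M)%N|) @ \oo --> (`|T m.+2 - 0| : R).
  apply: cvg_norm; apply: cvgB; first exact: cvg_cst.
  rewrite [X in X @ _](_ : _ = (fun M => T (M + m.+2)%N)); last by apply/funext => M; rewrite addnC.
  by rewrite cvg_shiftn; exact: T_cvg0.
rewrite subr0 in c.
apply: (ler_cvg_to c (cvg_cst _)); near=> M.
rewrite (le_trans (T_tail _ _))// ler_piMr//.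
  by rewrite mulr_ge0 ?exprn_ge0 ?mulr_ge0.
Unshelve. all: by end_near. Qed.

(** The first two partial sums contribute 1 and at most 53 / 75. The others form a geometric series
    with total at most (7 / 6)^2 * 3 / 14 = 7 / 24, and 53 / 75 + 7 / 24 is just below 1. *)
Lemma sum_alternating_le n : \sum_(0 <= m < n.+1) `|T m| <= 2.
Proof.
have T0 : T 0%N = 1 by rewrite /T big_nat1 u0 expr0 mul1r.
have T1 : `|T 1%N| <= 53 / 75.
  by rewrite /T big_nat_recr//= big_nat1 u0 !expr0 mul1r expr1 mulN1r.
have H k : \sum_(0 <= m < k) `|T m.+2| <= (49 / 36) * u 3%N * (1 - 7^-1 ^+ k).
  elim: k => [|k IH]; first by rewrite big_geq// expr0 subrr mulr0.
  rewrite big_nat_recr//= (le_trans (lerD IH (T_bound k)))// exprS.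
  by rewrite le_eqVlt; apply/orP; left; apply/eqP; field.
have H' k : \sum_(0 <= m < k) `|T m.+2| <= 7 / 24.
  have w : 0 <= 7^-1 ^+ k :> R by rewrite exprn_ge0.
  have v := u_ge0 3.
  have uw := mulr_ge0 v w.
  apply: (le_trans (H k)).
  have -> : 49 / 36 * u 3%N * (1 - 7^-1 ^+ k) = 49 / 36 * u 3%N - 49 / 36 * (u 3%N * 7^-1 ^+ k) by ring.
  by move: (u 3%N * 7^-1 ^+ k) uw => z hz; move: (u 3%N) v u3 => y hy hy3; lra.
case: n => [|n]; first by rewrite big_nat1 T0 normr1 ler1n.
rewrite big_nat_recl// T0 normr1 big_nat_recl//.
have := H' n; move: T1; set v := `|T 1%N|; set w := (X in X <= 7 / 24).
move=> h1 h2; rewrite -[2]/(1 + 1) lerD2l.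
have : v + w <= 53 / 75 + 7 / 24 by exact: lerD.
by move=> h; apply: (le_trans h); lra.
Qed.

End AlternatingTails.

Section SineTails.
Variable R : realType.

Let u (k : nat) : R := pi ^+ k.*2 / (k.*2.+1)`!%:R.
Let T (m : nat) : R := \sum_(0 <= k < m.+1) (-1) ^+ k * u k.

Let uS k : u k.+1 = u k * (pi ^+ 2 / ((k.*2.+2)%:R * (k.*2.+3)%:R)).
Proof.
rewrite /u doubleS 2!exprSr [(k.*2.+3)`!]factS [(k.*2.+2)`!]factS !natrM !invfM expr2.
ring.
Qed.

Let T_cvg0 : T @ \oo --> (0 : R).
Proof.
have := @cvg_sin_coeff' R pi; rewrite sinpi => h.
have -> : T = fun n => pi^-1 * series (sin_coeff' (pi : R)) n.+1.
  apply/funext => n; rewrite /series/= mulr_sumr; apply: eq_bigr => k _.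
  have := @pi_gt0 R; have f0 : (k.*2.+1)`!%:R != 0 :> R by rewrite pnatr_eq0 -lt0n fact_gt0.
  rewrite sin_coeff'_signr exprS /u; move: (pi : R) => q q0.
  by field; rewrite f0 gt_eqF.
rewrite -[X in _ --> X](mulr0 pi^-1).
by apply: cvgMr; rewrite cvg_shiftS.
Qed.

(** With pi^2 <= 256 / 25 one gets pi^2 / 6 - 1 <= 53 / 75, pi^6 / 7! <= 3 / 14, and ratios at most
    pi^2 / 72 <= 1 / 7 from index 3 on. *)
Let T_sum n : \sum_(0 <= m < n.+1) `|T m| <= 2.
Proof.
have hp := pi_sqr_le R; set p := pi ^+ 2 in hp.
have hp2 : 4 <= p.
  by have := @pi_ge2 R => h; rewrite /p expr2; nra.
apply: sum_alternating_le => [k|||||].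
- by rewrite divr_ge0 ?exprn_ge0 ?pi_ge0.
- by rewrite /u expr0 divr1.
- have -> : u 1%N = p / 6.
    by rewrite /u (_ : 1.*2 = 2)%N// !factS fact0 !natrM -/p; field.
  by rewrite ler_norml; lra.
- have -> : u 3%N = p ^+ 3 / 5040.
    by rewrite /u (_ : 3.*2 = 2 * 3)%N// exprM -/p (_ : (2 * 3).+1 = 7)%N// !factS fact0 !natrM; field.
  have : p ^+ 3 <= (256/25) ^+ 3 by rewrite lerXn2r ?nnegrE//; lra.
  lra.
- move=> k; rewrite uS -/p ler_wpM2l//.
    by rewrite divr_ge0 ?exprn_ge0 ?pi_ge0.
  rewrite ler_pdivrMr; last by rewrite -natrM ltr0n.
  have h8 : 8 <= ((3 + k)%N.*2.+2)%:R :> R by rewrite ler_nat; lia.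
  have h9 : 9 <= ((3 + k)%N.*2.+3)%:R :> R by rewrite ler_nat; lia.
  have : 8 * 9 <= ((3 + k)%N.*2.+2)%:R * ((3 + k)%N.*2.+3)%:R :> R by rewrite ler_pM.
  by move: (_ * ((3 + k)%N.*2.+3)%:R) => q; lra.
exact: T_cvg0.
Qed.

(* Coefficients of (sinh (pi y) / (pi y)) / (1 + y ^ 2), the simple zeros at
   y = i and y = - i being cancelled. *)
Definition sinh_quo (n : nat) : R :=
  if odd n then 0 else (-1) ^+ n./2 * T n./2.

Lemma sinh_quo0 : sinh_quo 0%N = 1.
Proof. by rewrite /sinh_quo /= expr0 mul1r /T big_nat1 /u expr0 mul1r expr0 divr1. Qed.

Lemma sinh_quo_sum n : \sum_(0 <= k < n) `|sinh_quo k.+1| <= 1.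
Proof.
have H m : \sum_(0 <= k < m.*2.+1) `|sinh_quo k| = \sum_(0 <= k < m.+1) `|T k|.
  elim: m => [|m IH].
    by rewrite double0 !big_nat1 /sinh_quo /= expr0 mul1r.
  rewrite doubleS big_nat_recr// big_nat_recr//= IH [in RHS]big_nat_recr//=.
  have -> : sinh_quo m.*2.+1 = 0 by rewrite /sinh_quo /= odd_double.
  rewrite normr0 addr0; congr (_ + _).
  rewrite /sinh_quo /= odd_double /= doubleK.
  by rewrite normrM normr_sign mul1r.
suff : \sum_(0 <= k < n.+1) `|sinh_quo k| <= 2.
  rewrite big_nat_recl// sinh_quo0 normr1; lra.
apply: le_trans (T_sum n); rewrite -H.
rewrite (@big_cat_nat _ _ _ n.+1 0 n.*2.+1)//= ?ltnS; last by rewrite -addnn leq_addr.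
by rewrite lerDl sumr_ge0.
Qed.

(** The left side is coefficient [n] of the product by 1 + y^2. Dividing by 1 + y^2 produces
    alternating partial sums, since T_k - T_(k-1) = (-1)^k u_k. *)
Lemma sinh_quoE n : sinh_quo n + (if n is m.+2 then sinh_quo m else 0) =
  (~~ odd n)%:R * (pi ^+ n / (n.+1)`!%:R).
Proof.
case: n => [|[|m]].
- by rewrite sinh_quo0 addr0 expr0 mul1r divr1.
- by rewrite /sinh_quo /= addr0 mul0r.
rewrite /sinh_quo oddS oddS negbK; case: (boolP (odd m)) => om /=.
  by rewrite addr0 mul0r.
rewrite mul1r /T exprS big_nat_recr//= mulrDr mulN1r mulNr addrAC addNr add0r.
have sq : (-1) ^+ m./2 * (-1) ^+ m./2 = 1 :> R by rewrite -expr2 sqrr_sign.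
transitivity ((-1) ^+ m./2 * (-1) ^+ m./2 * u m./2.+1); first by rewrite exprS; ring.
rewrite sq mul1r /u doubleS.
by rewrite (_ : (m./2).*2 = m)// -[RHS]odd_double_half (negbTE om).
Qed.

End SineTails.

(** * Coefficient bounds and convergence for |t| < pi *)

Section Radius.
Variable R : realType.
Local Notation C := R[i].
Local Notation normc := (@Normc.normc R).

Lemma unit_natR n : (n.+1%:R : R) \is a GRing.unit.
Proof. by rewrite unitfE pnatr_eq0. Qed.

Let s : nat -> R := fps_div (@fps_t R) (@fps_sinh R).
Let a (n : nat) : R := s n * pi ^+ n.
Let d (n : nat) : R := (n == 0%N)%:R + (n == 2%N)%:R.

Let fps_mul_d (e : nat -> R) n :
  fps_mul e d n = e n + (if n is m.+2 then e m else 0).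
Proof.
rewrite fps_mulC /fps_mul; case: n => [|[|m]].
- by rewrite big_ord_recl big_ord0 /d /= !addr0 mul1r.
- by rewrite !big_ord_recl big_ord0 /d /= !addr0 mul1r mul0r addr0.
rewrite !big_ord_recl /d /= big1 => [|i _]; last by rewrite /= addr0 mul0r.
by rewrite /bump /= !addr0 add0r mul1r mul0r add0r mul1r subn0 subSS subSS subn0.
Qed.

(** This is (t / sinh t) (sinh t / t) = 1 in the variable y = t / pi; dividing sinh by t is the
    index shift [n.+1]. *)
Let a_sinh : fps_mul a (fps_mul (@sinh_quo R) d) = @fps_one R.
Proof.
have e0 : fps_mul (@sinh_quo R) d = fun n => pi ^+ n * @fps_sinh R n.+1.
  apply/funext => n; rewrite fps_mul_d sinh_quoE fps_sinhE; last exact: unit_natR.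
  by rewrite /= mulrCA.
have := fps_t_div_sinh unit_natR; rewrite -/s => H.
rewrite e0; apply/funext => n.
have := congr1 (@^~ n.+1) H; rewrite /fps_mul big_ord_recr/= subnn fps_sinh0; last exact: unit_natR.
rewrite mulr0 addr0 /fps_t /fps_one eqSS => /(congr1 (fun x => pi ^+ n * x)).
have -> : pi ^+ n * (n == 0%N)%:R = (n == 0%N)%:R :> R.
  by case: n {H} => [|n]; rewrite ?mulr0 // expr0 mul1r.
move=> <-; rewrite mulr_sumr; apply: eq_bigr => i _; rewrite /a subSn ?leq_ord//.
have -> : pi ^+ n = pi ^+ i * pi ^+ (n - i) :> R by rewrite -exprD subnKC// leq_ord.
ring.
Qed.

(* In y = t / pi, [a] is t / sinh t and [d] is 1 + y ^ 2, which removes the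
   poles at y = i and y = - i. *)
Let G := fps_mul a d.

(** From [G * sinh_quo = 1], G_n is minus a combination of earlier coefficients of [G] whose weights
    have absolute sum at most 1. *)
Let G_bound n : `|G n| <= 1.
Proof.
have GS : fps_mul G (@sinh_quo R) = @fps_one R.
  by rewrite /G -fps_mulA [fps_mul d _]fps_mulC a_sinh.
elim/ltn_ind: n => n IH.
have := congr1 (@^~ n) GS; rewrite /fps_mul big_ord_recr /= subnn sinh_quo0 mulr1.
case: n IH => [|n] IH.
  by rewrite big_ord0 add0r => ->; rewrite normr1.
move=> /eqP; rewrite addrC addr_eq0 => /eqP ->; rewrite normrN.
apply: le_trans (sinh_quo_sum R n.+1).
apply: le_trans (ler_norm_sum _ _ _) _.
rewrite big_mkord [leRHS](reindex_inj rev_ord_inj) /=; apply: ler_sum => i _.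
rewrite normrM subSS subSn ?leq_ord// -[leRHS]mul1r ler_wpM2r// IH//.
Qed.

(** Dividing [G] by 1 + y^2 again gives a_n = G_n - a_(n-2), hence at most linear growth. The
    recursion has step 2, so the induction carries two consecutive bounds. *)
Lemma fps_t_div_sinh_bound n : `|s n| * pi ^+ n <= n.+1%:R.
Proof.
have -> : `|s n| * pi ^+ n = `|a n|.
  by rewrite /a normrM [`|pi ^+ n|]ger0_norm// exprn_ge0// pi_ge0.
suff : `|a n| <= n.+1%:R /\ `|a n.+1| <= n.+2%:R by case.
have aE m : a m = G m - (if m is k.+2 then a k else 0).
  by rewrite /G fps_mul_d addrK.
elim: n => [|n [IH1 IH2]]; split => //.
- by rewrite aE subr0.
- by rewrite aE subr0 (le_trans (G_bound _))// ler1n.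
rewrite aE (le_trans (ler_normB _ _))// (le_trans (lerD (G_bound _) IH1))//.
by rewrite nat1r ler_nat.
Qed.

(** This is the Cauchy square of the geometric series. *)
Lemma cvg_series_nat_geometric (r : R) : 0 <= r -> r < 1 ->
  cvgn (series (fun n => n.+1%:R * r ^+ n)).
Proof.
move=> r0 r1.
have cg : cvgn (series (fun n => r ^+ n)).
  have := @is_cvg_geometric_series R 1 r; rewrite ger0_norm// => /(_ r1).
  by rewrite -exprn_geometric.
have [+ _] := cauchy_nonneg (fun n => exprn_ge0 n r0) (fun n => exprn_ge0 n r0) cg cg.
rewrite [X in series X](_ : _ = fun n => n.+1%:R * r ^+ n)//.
apply/funext => n; rewrite /fps_mul (eq_bigr (fun=> r ^+ n)) => [|i _].
  by rewrite sumr_const card_ord mulr_natl.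
by rewrite -exprD subnKC// leq_ord.
Qed.

Lemma abs_summable_t_div_sinh (t : C) : normc t < pi ->
  abs_summable (fps_scale t (fps_div (@fps_t C) (@fps_sinh C))).
Proof.
move=> tpi; set r := normc t / pi.
have r0 : 0 <= r by rewrite divr_ge0 ?normc_ge0 ?pi_ge0.
have r1 : r < 1 by rewrite ltr_pdivrMr ?pi_gt0// mul1r.
apply: abs_summable_le (cvg_series_nat_geometric r0 r1) => n.
rewrite -(map_fps_t_div_sinh (real_complex R) unit_natR (@unit_natC R)) /fps_scale /= -/s.
rewrite Normc.normcM normcX normc_real /r expr_div_n.
rewrite [leRHS]mulrCA ler_wpM2l ?exprn_ge0 ?normc_ge0//.
by rewrite ler_pdivlMr ?exprn_gt0 ?pi_gt0// fps_t_div_sinh_bound.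
Qed.

Lemma abs_summable_exp (z : C) : abs_summable (fun n => z ^+ n / n`!%:R).
Proof.
apply: abs_summable_le (is_cvg_series_exp_coeff (normc z)) => n.
rewrite Normc.normcM normcX Normc.normcV /exp_coeff /=.
by rewrite -(rmorph_nat (real_complex R)) normc_real ger0_norm.
Qed.

Lemma csinhE (t : C) : csinh t = csum (fps_scale t (@fps_sinh C)) /\
  abs_summable (fps_scale t (@fps_sinh C)).
Proof.
have e1 : fps_scale t (@fps_sinh C) =
    fun n => 2^-1 * (t ^+ n / n`!%:R + (-1) * ((- t) ^+ n / n`!%:R)).
  apply/funext => n; rewrite /fps_scale /fps_sinh /fps_exp -[- t]mulN1r exprMn.
  by rewrite expr1n mul1r mulrC -!mulrA [_ * (_ * t ^+ n)]mulrC; ring.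
have s1 := @abs_summable_exp t; have s2 := @abs_summable_exp (- t).
have s3 := @abs_summableZ R (-1) _ s2; have s4 := abs_summableD s1 s3.
rewrite e1; split; last exact: abs_summableZ.
rewrite csumZ// csumD// csumZ// /csinh /cexp mulN1r; exact: mulrC.
Qed.

(** The Cauchy product with sinh gives sum * sinh t = t. For t nonzero this also shows that sinh t
    is nonzero; for t = 0 the sum is its constant coefficient, 1. *)
Lemma csum_t_div_sinh (t : C) : normc t < pi ->
  csum (fps_scale t (fps_div (@fps_t C) (@fps_sinh C))) = t_over_sinh t.
Proof.
move=> tpi; have sq := abs_summable_t_div_sinh tpi.
have [eS sS] := csinhE t.
have := csum_fps_mul sq sS.
rewrite -fps_scaleM fps_t_div_sinh; last exact: unit_natC.
have -> : csum (fps_scale t (@fps_t C)) = t.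
  (* From two terms on, the partial sums are constantly [t]. *)
  apply: csum_unique; rewrite -(cvg_shiftn 2).
  rewrite [X in X @ _](_ : _ = fun=> t : C^o); first exact: cvg_cst.
  apply/funext => n; rewrite /= addn2 /series /= big_nat_recl// big_nat_recl// big1 => [|i _].
    by rewrite /fps_scale /fps_t mulr0 add0r addr0 expr1 mulr1.
  by rewrite /fps_scale /fps_t mulr0.
rewrite -eS /t_over_sinh; case: eqVneq => [t0 _|t0 e].
  rewrite csumS// /fps_scale expr0 mul1r.
  rewrite (_ : (fun n => _) = fun=> 0); last by apply/funext => n; rewrite t0 exprS !mul0r.
  rewrite [csum _](_ : _ = 0) ?addr0; last first.
    apply: csum_unique; rewrite [X in X @ _](_ : _ = fun=> 0); first exact: cvg_cst.
    by apply/funext => n; rewrite /series/= big1.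
  have := congr1 (@^~ 1%N) (fps_t_div_sinh (@unit_natC R)).
  rewrite /fps_mul !big_ord_recl big_ord0 /= fps_sinh0 ?fps_sinh1; try exact: unit_natC.
  by rewrite mulr1 mulr0 !addr0.
have s0 : csinh t != 0 by apply: contra_neq t0 => s0; rewrite e s0 mulr0.
by apply: (mulIf s0); rewrite divfK// -e.
Qed.

Theorem Ppoly_gf_cvg (x t : C) : `|t| < pi%:C ->
  series (fun n => (@Ppoly R n).[x] * t ^+ n / n`!%:R : C^o) @ \oo -->
    (t_over_sinh t * cexp (t * x) : C^o).
Proof.
move=> ltpi; have tpi : normc t < pi.
  by move: ltpi; rewrite norm_normc ltcR.
have sq := abs_summable_t_div_sinh tpi; have se := @abs_summable_exp (t * x).
rewrite -csum_t_div_sinh// /cexp -csum_fps_mul//.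
rewrite [X in series X](_ : _ = fps_mul (fps_scale t (fps_div (@fps_t C) (@fps_sinh C)))
  (fun n => (t * x) ^+ n / n`!%:R)); first exact: cvg_csum (abs_summable_fps_mul sq se).
apply/funext => n; rewrite PpolyE Pcoef_sum hornerM -(rmorph_nat (@polyC C)) hornerC.
have w0 : n`!%:R != 0 :> C by rewrite pnatr_eq0 -lt0n fact_gt0.
rewrite horner_sum; set S := \sum_(i < _) _.
transitivity (t ^+ n * S); first by field.
rewrite /S /fps_mul mulr_sumr; apply: eq_bigr => i _.
rewrite hornerZ hornerXn /fps_scale exprMn.
have -> : t ^+ n = t ^+ i * t ^+ (n - i) by rewrite -exprD subnKC// leq_ord.
ring.
Qed.

End Radius.

(** * Integrals over (-1, 1) *)

Section AffineChange.
Variables (R : realType) (a b : R) (phi : R -> R).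
Hypothesis a_gt0 : 0 < a.
Hypothesis phiE : forall x, phi x = a * x + b.
Local Notation mu := (@lebesgue_measure R).
Local Notation mfunR D f := (@measurable_fun _ _ (measurableTypeR R) _ D f).

Lemma measurable_affine (D : set R) :
  @measurable_fun _ _ (measurableTypeR R) (measurableTypeR R) D phi.
Proof.
rewrite (_ : phi = (fun x => a * x + b)); last by apply/funext => x.
by apply: measurable_funD => //; exact: mulrl_measurable.
Qed.

(** The right side is a measure, a rescaled pushforward, that agrees with Lebesgue measure on
    half-open intervals; uniqueness concludes. *)
Lemma lebesgue_measure_affine (A : set R) : measurable A ->
  mu A = (a%:E * mu (phi @^-1` A))%E.
Proof.
move=> mA.
have mphi : measurable_fun [set: measurableTypeR R] (phi : _ -> measurableTypeR R).
  exact: measurable_affine.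
pose m := mscale (NngNum (ltW a_gt0))
  (measure_function_pushforward__canonical__measure_function_Measure mu mphi).
rewrite -[RHS]/(m A).
apply: (@lebesgue_measure_unique _ m) => // _ [[c d] _ <-] /=.
rewrite /m /mscale /= /pushforward.
have -> : phi @^-1` `]c, d] = `](c - b) / a, (d - b) / a]%classic.
  apply/seteqP; split => x /=; rewrite !in_itv /= phiE ler_pdivlMr// ltr_pdivrMr//.
    by rewrite mulrC ltrBlDr lerBrDr.
  by rewrite mulrC ltrBlDr lerBrDr.
rewrite !lebesgue_measure_itv /= !lte_fin ltr_pM2r ?invr_gt0// ltrD2r.
case: ifPn => cd; last by rewrite mule0.
by rewrite -!EFinB -EFinM; congr (_%:E); field; rewrite gt_eqF.
Qed.

Lemma ge0_integral_affine (D : set R) (f : R -> \bar R) :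
  measurable D -> mfunR D f -> (forall x, D x -> (0 <= f x)%E) ->
  (\int[mu]_(x in D) f x = a%:E * \int[mu]_(x in phi @^-1` D) f (phi x))%E.
Proof.
move=> mD mf f0.
have mphi : measurable_fun [set: measurableTypeR R] (phi : _ -> measurableTypeR R).
  exact: measurable_affine.
rewrite -(@ge0_integral_pushforward _ _
  (measurableTypeR R) (measurableTypeR R) R phi mphi mu D f)//; last first.
  by move=> x; rewrite inE; exact: f0.
rewrite -[a in RHS]/((NngNum (ltW a_gt0))%:num).
rewrite -(@ge0_integral_mscale _ _ R
  (measure_function_pushforward__canonical__measure_function_Measure mu mphi)
  D mD (NngNum (ltW a_gt0)) f)//.
apply: eq_measure_integral => A mA _.
exact: lebesgue_measure_affine.
Qed.

Lemma negligible_affine (A : set R) : mu.-negligible A -> mu.-negligible (phi @^-1` A).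
Proof.
move=> [B [mB B0 AB]]; exists (phi @^-1` B); split.
- rewrite -[X in measurable X]setTI; exact: measurable_affine.
- have := lebesgue_measure_affine mB; rewrite B0 => /esym/eqP.
  by rewrite mule_eq0 eqe gt_eqF//= => /eqP.
- by move=> x; exact: AB.
Qed.

Lemma ae_affine (P : set R) : {ae mu, forall x, P x} -> {ae mu, forall x, P (phi x)}.
Proof. by move=> /negligible_affine. Qed.

End AffineChange.

(** * Invariance of the integral under averaging *)

Section Fold.
Variable R : realType.
Local Notation mu := (@lebesgue_measure R).
Local Notation mfunR D f := (@measurable_fun _ _ (measurableTypeR R) _ D f).
Local Notation I := (@I11 R).
Local Notation C := R[i].

(** [half_up] and [half_dn] are the two inverse branches of the digit shift; they map (-1, 1) onto
    (0, 1) and (-1, 0). *)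
Definition half_up (x : R) : R := (x + 1) / 2%:R.
Definition half_dn (x : R) : R := (x - 1) / 2%:R.

Lemma half_upE x : half_up x = 2^-1 * x + 2^-1.
Proof. by rewrite /half_up; field. Qed.

Lemma half_dnE x : half_dn x = 2^-1 * x + (- 2^-1).
Proof. by rewrite /half_dn; field. Qed.

Let h0 : 0 < 2^-1 :> R. Proof. by rewrite invr_gt0. Qed.

Lemma I11P x : I x <-> -1 < x /\ x < 1.
Proof. by rewrite /I11 /= in_itv /=; split => [/andP[]|[-> ->]]. Qed.

Lemma measurable_I11 : @measurable _ (measurableTypeR R) I.
Proof. exact: measurable_itv. Qed.

Lemma mu_I11 : mu I = 2%:E.
Proof.
rewrite /I11 lebesgue_measure_itv /= lte_fin ifT; last by lra.
by rewrite -EFinB; congr (_%:E); lra.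
Qed.

Lemma half_up_I11 x : I x -> I (half_up x).
Proof. by move=> /I11P[h1 h2]; apply/I11P; rewrite half_upE; split; lra. Qed.

Lemma half_dn_I11 x : I x -> I (half_dn x).
Proof. by move=> /I11P[h1 h2]; apply/I11P; rewrite half_dnE; split; lra. Qed.

Lemma measurable_half_up (D : set R) :
  @measurable_fun _ _ (measurableTypeR R) (measurableTypeR R) D half_up.
Proof. exact: measurable_affine half_upE _. Qed.

Lemma measurable_half_dn (D : set R) :
  @measurable_fun _ _ (measurableTypeR R) (measurableTypeR R) D half_dn.
Proof. exact: measurable_affine half_dnE _. Qed.

Lemma measurable_fun_half_up d (T : measurableType d) (f : R -> T) :
  mfunR I f -> mfunR I (f \o half_up).
Proof.
move=> mf; have s : half_up @` I `<=` I by move=> _ [x xI <-]; exact: half_up_I11.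
exact: (measurable_comp measurable_I11 s mf (@measurable_half_up I)).
Qed.

Lemma measurable_fun_half_dn d (T : measurableType d) (f : R -> T) :
  mfunR I f -> mfunR I (f \o half_dn).
Proof.
move=> mf; have s : half_dn @` I `<=` I by move=> _ [x xI <-]; exact: half_dn_I11.
exact: (measurable_comp measurable_I11 s mf (@measurable_half_dn I)).
Qed.

Lemma ae_half (P : set R) : {ae mu, forall x, P x} ->
  {ae mu, forall x, P (half_up x) /\ P (half_dn x)}.
Proof.
move=> aP; have aP1 := ae_affine h0 half_upE aP.
have aP2 := ae_affine h0 half_dnE aP.
have F : Filter (almost_everywhere mu) by exact: ae_filter_ringOfSetsType.
exact: (@filterI _ _ F _ _ aP1 aP2).
Qed.

(** Split the interval at 0 and change variables on each half; both Jacobians are 1 / 2. *)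
Lemma ge0_integral_fold (f : R -> \bar R) : mfunR I f ->
  (forall x, I x -> (0 <= f x)%E) ->
  (\int[mu]_(x in I) f x = 2^-1%:E *
    (\int[mu]_(x in I) f (half_up x) + \int[mu]_(x in I) f (half_dn x)))%E.
Proof.
move=> mf f0.
have m1 : measurable (`]-1, 0] : set R) by exact: measurable_itv.
have m2 : measurable (`]0, 1[ : set R) by exact: measurable_itv.
have m3 : measurable (`]-1, 0[ : set R) by exact: measurable_itv.
have IU : I = `]-1, 0]%classic `|` `]0, 1[%classic.
  apply/seteqP; split => x; rewrite /I11 /= !in_itv /=.
    by move=> /andP[-> ->]; rewrite andbT /=; apply/orP; case: ltP => h; rewrite ?orbT.
  by move=> [/andP[h1 h2]|/andP[h1 h2]]; apply/andP; split; lra.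
have s1 : `]-1, 0]%classic `<=` I by rewrite IU; exact: subsetUl.
have s2 : `]0, 1[%classic `<=` I by rewrite IU; exact: subsetUr.
have s3 : `]-1, 0[%classic `<=` I.
  by apply: subset_trans s1; apply: subset_itvl; rewrite bnd_simp.
rewrite {1}IU ge0_integral_setU//; last 3 first.
- by rewrite -IU.
- by rewrite -IU.
- apply/disj_setPS => x /=; rewrite !in_itv /= => -[/andP[_ h1] /andP[h2 _]].
  by move: h2; rewrite ltNge h1.
(* The endpoint 0, a null set, is dropped so that the left half is exactly the image of
   [half_dn]. *)
rewrite -integral_itv_bndo_bndc; last exact: (measurable_funS measurable_I11 s3 mf).
rewrite (ge0_integral_affine h0 half_upE m2); last 2 first.
- exact: (measurable_funS measurable_I11 s2 mf).
- by move=> x /s2; exact: f0.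
rewrite (ge0_integral_affine h0 half_dnE m3); last 2 first.
- exact: (measurable_funS measurable_I11 s3 mf).
- by move=> x /s3; exact: f0.
have -> : half_up @^-1` `]0, 1[ = I.
  apply/seteqP; split => x; rewrite /= in_itv /= half_upE.
    by move=> /andP[? ?]; apply/I11P; split; lra.
  by move=> /I11P[? ?]; apply/andP; split; lra.
have -> : half_dn @^-1` `]-1, 0[ = I.
  apply/seteqP; split => x; rewrite /= in_itv /= half_dnE.
    by move=> /andP[? ?]; apply/I11P; split; lra.
  by move=> /I11P[? ?]; apply/andP; split; lra.
have u0 : (0 <= \int[mu]_(x in I) f (half_up x))%E.
  by apply: integral_ge0 => x xI; apply: f0; exact: half_up_I11.
have d0 : (0 <= \int[mu]_(x in I) f (half_dn x))%E.
  by apply: integral_ge0 => x xI; apply: f0; exact: half_dn_I11.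
by rewrite [LHS]addeC [RHS]ge0_muleDr.
Qed.

Local Notation intble f := (mu.-integrable I (EFin \o f)).

Lemma integrable_half (f : R -> R) : intble f ->
  intble (f \o half_up) /\ intble (f \o half_dn).
Proof.
move=> /integrableP[mf foo].
have mf' : mfunR I f by exact/measurable_EFinP.
have := @ge0_integral_fold (fun x => `|(EFin \o f) x|%E).
move=> /(_ (measurableT_comp (@abse_measurable _ setT) mf) (fun _ _ => abse_ge0 _)) e.
move: foo; rewrite e => foo.
have A0 : (0 <= \int[mu]_(x in I) `|(EFin \o f) (half_up x)|)%E by exact: integral_ge0.
have B0 : (0 <= \int[mu]_(x in I) `|(EFin \o f) (half_dn x)|)%E by exact: integral_ge0.
have fin : (\int[mu]_(x in I) `|(EFin \o f) (half_up x)| +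
    \int[mu]_(x in I) `|(EFin \o f) (half_dn x)| < +oo)%E.
  by move: foo; rewrite muleC -lte_pdivlMr// => /lt_le_trans; apply; rewrite leey.
split; apply/integrableP; split.
- apply/measurable_EFinP; exact: measurable_fun_half_up.
- by apply: le_lt_trans fin; rewrite leeDl.
- apply/measurable_EFinP; exact: measurable_fun_half_dn.
- by apply: le_lt_trans fin; rewrite leeDr.
Qed.

Lemma ge0_Rintegral_fold (f : R -> R) : intble f -> (forall x, 0 <= f x) ->
  \int[mu]_(x in I) f x =
  2^-1 * (\int[mu]_(x in I) f (half_up x) + \int[mu]_(x in I) f (half_dn x)).
Proof.
move=> fi f0; have [u d] := integrable_half fi.
rewrite /Rintegral ge0_integral_fold; last 2 first.
- exact: measurable_int fi.
- by move=> x _; rewrite lee_fin.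
have fu : (\int[mu]_(x in I) (f (half_up x))%:E \is a fin_num)%E := integrable_fin_num measurable_I11 u.
have fd : (\int[mu]_(x in I) (f (half_dn x))%:E \is a fin_num)%E := integrable_fin_num measurable_I11 d.
rewrite fineM//; last by rewrite fin_numD fu fd.
by rewrite fineD.
Qed.

(** The nonnegative case is applied to the positive and the negative part. *)
Lemma Rintegral_fold (f : R -> R) : intble f ->
  \int[mu]_(x in I) f x =
  \int[mu]_(x in I) ((f (half_up x) + f (half_dn x)) / 2%:R).
Proof.
move=> fi; have [u d] := integrable_half fi.
have mI : @measurable _ (measurableTypeR R) I := measurable_I11.
rewrite RintegralZr//; last first.
  by have := integrableD mI u d; apply: eq_integrable.
rewrite RintegralD// mulrC.
have pi := integrable_funrpos mI fi; have ni := integrable_funrneg mI fi.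
have [pu pd] := integrable_half pi; have [nu nd] := integrable_half ni.
have fE x : f x = f^\+ x - f^\- x by rewrite -[in LHS](funrposBneg f).
under eq_Rintegral do rewrite fE.
under [in RHS]eq_Rintegral do rewrite fE.
under [X in _ + X]eq_Rintegral do rewrite fE.
rewrite !RintegralB// (ge0_Rintegral_fold pi) ?(ge0_Rintegral_fold ni) ; last 2 first.
- by move=> x; exact: funrneg_ge0.
- by move=> x; exact: funrpos_ge0.
ring.
Qed.

End Fold.

(** * Complex-valued integrals *)

Section ComplexIntegral.
Variable R : realType.
Local Notation mu := (@lebesgue_measure R).
Local Notation I := (@I11 R).
Local Notation C := R[i].
Local Notation Re := (@complex.Re R).
Local Notation Im := (@complex.Im R).
Local Notation normc := (@Normc.normc R).
Local Notation mfunI f := (@measurable_fun _ _ (measurableTypeR R) _ I f).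
Local Notation intble f := (mu.-integrable I (EFin \o f)).
Implicit Types (f g w : R -> C) (z : C).

Let mI : @measurable _ (measurableTypeR R) I := @measurable_I11 R.

Lemma ReM (x y : C) : Re (x * y) = Re x * Re y - Im x * Im y.
Proof. by case: x y => a b [c d]. Qed.

Lemma ImM (x y : C) : Im (x * y) = Re x * Im y + Im x * Re y.
Proof. by case: x y => a b [c d]. Qed.

Lemma ReD (x y : C) : Re (x + y) = Re x + Re y.
Proof. by case: x y => a b [c d]. Qed.

Lemma ImD (x y : C) : Im (x + y) = Im x + Im y.
Proof. by case: x y => a b [c d]. Qed.

Lemma half_real : (2%:R : C)^-1 = (2^-1 : R)%:C.
Proof. by rewrite rmorphV ?unitfE// rmorph_nat. Qed.

Definition cmeasurable f := mfunI (fun x => Re (f x)) /\ mfunI (fun x => Im (f x)).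

Definition cintegrable f := intble (fun x => Re (f x)) /\ intble (fun x => Im (f x)).

Definition cbounded f := exists M : R, forall x, I x -> normc (f x) <= M.

Lemma cintegrable_measurable f : cintegrable f -> cmeasurable f.
Proof.
by move=> [h1 h2]; split; apply/measurable_EFinP; [exact: measurable_int h1|exact: measurable_int h2].
Qed.

Lemma cmeasurable_cst z : cmeasurable (fun=> z).
Proof. by split; exact: measurable_cst. Qed.

Lemma cmeasurable_real (h : R -> R) : mfunI h -> cmeasurable (fun x => (h x)%:C).
Proof. by move=> mh; split => //=; exact: measurable_cst. Qed.

Lemma cmeasurableD f g : cmeasurable f -> cmeasurable g -> cmeasurable (fun x => f x + g x).
Proof.
move=> [f1 f2] [g1 g2]; split.
  by under eq_fun do rewrite ReD; exact: measurable_funD.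
by under eq_fun do rewrite ImD; exact: measurable_funD.
Qed.

Lemma cmeasurableM f g : cmeasurable f -> cmeasurable g -> cmeasurable (fun x => f x * g x).
Proof.
move=> [f1 f2] [g1 g2]; split.
  by under eq_fun do rewrite ReM; apply: measurable_funB; exact: measurable_funM.
by under eq_fun do rewrite ImM; apply: measurable_funD; exact: measurable_funM.
Qed.

Lemma cmeasurable_half f : cmeasurable f ->
  cmeasurable (fun x => (f (half_up x) + f (half_dn x)) / 2%:R).
Proof.
move=> [f1 f2]; apply: cmeasurableM; last exact: cmeasurable_cst.
apply: cmeasurableD; split; [exact: (measurable_fun_half_up f1)|
  exact: (measurable_fun_half_up f2)|exact: (measurable_fun_half_dn f1)|
  exact: (measurable_fun_half_dn f2)].
Qed.

Lemma cmeasurable_csum (u : nat -> R -> C) :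
  (forall n, cmeasurable (u n)) -> (forall x, I x -> abs_summable (u ^~ x)) ->
  cmeasurable (fun x => csum (u ^~ x)).
Proof.
move=> mu_ su; have ms n : cmeasurable (fun x => series (u ^~ x) n).
  elim: n => [|n IH].
    by rewrite (_ : (fun x => _) = fun=> 0); [exact: cmeasurable_cst|
      apply/funext => x; rewrite /series/= big_geq].
  rewrite (_ : (fun x => _) = fun x => series (u ^~ x) n + u n x); first exact: cmeasurableD.
  by apply/funext => x; rewrite seriesSr.
split.
- apply: (@measurable_fun_cvg _ (measurableTypeR R) R I (fun n x => Re (series (u ^~ x) n))).
    by move=> n; have [] := ms n.
  by move=> x xI; have /ccvgP[] := cvg_csum (su x xI).
- apply: (@measurable_fun_cvg _ (measurableTypeR R) R I (fun n x => Im (series (u ^~ x) n))).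
    by move=> n; have [] := ms n.
  by move=> x xI; have /ccvgP[] := cvg_csum (su x xI).
Qed.

Lemma eq_cint f g : (forall x, I x -> f x = g x) -> cint f = cint g.
Proof. by move=> fg; congr (_ +i* _); apply: eq_Rintegral => x /set_mem xI; rewrite fg. Qed.

Lemma ae_cint f g : cmeasurable f -> cmeasurable g -> ae11 f g -> cint f = cint g.
Proof.
move=> [f1 f2] [g1 g2] fg.
have F : Filter (almost_everywhere mu) by exact: ae_filter_ringOfSetsType.
congr (_ +i* _); congr fine; apply: ae_eq_integral => //; try exact/measurable_EFinP.
  by apply: (@filterS _ _ F _ _ _ fg) => x fgx xI; rewrite fgx.
by apply: (@filterS _ _ F _ _ _ fg) => x fgx xI; rewrite fgx.
Qed.

Lemma cintegrableD f g : cintegrable f -> cintegrable g -> cintegrable (fun x => f x + g x).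
Proof.
move=> [f1 f2] [g1 g2]; split.
  by have := integrableD mI f1 g1; apply: eq_integrable => // x _; rewrite /= ReD.
by have := integrableD mI f2 g2; apply: eq_integrable => // x _; rewrite /= ImD.
Qed.

Lemma cintD f g : cintegrable f -> cintegrable g ->
  cint (fun x => f x + g x) = cint f + cint g.
Proof.
move=> [f1 f2] [g1 g2]; rewrite /cint.
under eq_Rintegral do rewrite ReD.
under [X in _ +i* X]eq_Rintegral do rewrite ImD.
by rewrite !RintegralD.
Qed.

Lemma bounded_real (h : R -> R) (M : R) : (forall x, I x -> `|h x| <= M) -> [bounded h x | x in I].
Proof.
move=> hM; exists M; split; first exact: num_real.
by move=> y My x xI /=; rewrite (le_trans (hM x xI))// ltW.
Qed.

Lemma cintegrableM w f : cmeasurable w -> cbounded w -> cintegrable f ->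
  cintegrable (fun x => w x * f x).
Proof.
move=> [w1 w2] [M wM] [f1 f2].
have b1 : [bounded Re (w x) | x in I].
  by apply: (bounded_real (M := M)) => x xI; rewrite (le_trans (normr_Re _))// wM.
have b2 : [bounded Im (w x) | x in I].
  by apply: (bounded_real (M := M)) => x xI; rewrite (le_trans (normr_Im _))// wM.
split.
  have := integrableB mI (integrableMr mI w1 b1 f1) (integrableMr mI w2 b2 f2).
  by apply: eq_integrable => // x _; rewrite /= ReM.
have := integrableD mI (integrableMr mI w1 b1 f2) (integrableMr mI w2 b2 f1).
by apply: eq_integrable => // x _; rewrite /= ImM.
Qed.

Lemma cbounded_cst z : cbounded (fun=> z).
Proof. by exists (normc z). Qed.

Lemma cintegrableZ z f : cintegrable f -> cintegrable (fun x => z * f x).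
Proof. by apply: cintegrableM; [exact: cmeasurable_cst|exact: cbounded_cst]. Qed.

Lemma cintZ z f : cintegrable f -> cint (fun x => z * f x) = z * cint f.
Proof.
move=> [f1 f2]; rewrite /cint.
under eq_Rintegral do rewrite ReM.
under [X in _ +i* X]eq_Rintegral do rewrite ImM.
have Z (a : R) (h : R -> R) : intble h -> intble (fun x => a * h x).
  by move=> hi; have := integrableZl mI a hi; apply: eq_integrable.
rewrite RintegralB//; [|exact: Z|exact: Z].
rewrite RintegralD//; [|exact: Z|exact: Z].
by rewrite !RintegralZl//; case: z.
Qed.

Lemma cintB f g : cintegrable f -> cintegrable g ->
  cint (fun x => f x - g x) = cint f - cint g.
Proof.
move=> fi gi; rewrite -mulN1r -cintZ// -cintD//; last exact: cintegrableZ.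
by apply: eq_cint => x _; rewrite mulN1r.
Qed.

Lemma cintegrable_half f : cintegrable f ->
  cintegrable (fun x => (f (half_up x) + f (half_dn x)) / 2%:R).
Proof.
move=> [f1 f2]; have [u1 d1] := integrable_half f1; have [u2 d2] := integrable_half f2.
have : cintegrable (fun x => (2%:R)^-1 * (f (half_up x) + f (half_dn x))).
  by apply: cintegrableZ; apply: cintegrableD.
by under eq_fun do rewrite mulrC.
Qed.

Lemma cint_fold f : cintegrable f ->
  cint f = cint (fun x => (f (half_up x) + f (half_dn x)) / 2%:R).
Proof.
move=> [f1 f2]; rewrite /cint Rintegral_fold// [X in _ +i* X]Rintegral_fold//.
congr (_ +i* _); apply: eq_Rintegral => x _.
  by rewrite half_real ReM ReD /= mulr0 subr0.
by rewrite half_real ImM ImD /= mulr0 add0r.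
Qed.

Lemma cmeasurable_bounded_integrable f : cmeasurable f -> cbounded f -> cintegrable f.
Proof.
move=> [f1 f2] [M fM]; have fin : (mu I < +oo)%E by rewrite mu_I11 ltry.
split; apply: measurable_bounded_integrable => //.
  by apply: (bounded_real (M := M)) => x xI; rewrite (le_trans (normr_Re _))// fM.
by apply: (bounded_real (M := M)) => x xI; rewrite (le_trans (normr_Im _))// fM.
Qed.

Lemma cboundedD f g : cbounded f -> cbounded g -> cbounded (fun x => f x + g x).
Proof.
move=> [M fM] [N gN]; exists (M + N) => x xI.
by rewrite (le_trans (le_normcD _ _))// lerD ?fM ?gN.
Qed.

Lemma cboundedM f g : cbounded f -> cbounded g -> cbounded (fun x => f x * g x).
Proof.
move=> [M fM] [N gN]; exists (M * N) => x xI.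
by rewrite Normc.normcM ler_pM ?normc_ge0 ?fM ?gN.
Qed.

Lemma tame_horner (p : {poly C}) :
  cmeasurable (fun x => p.[x%:C]) /\ cbounded (fun x => p.[x%:C]).
Proof.
have mX : cmeasurable (fun x => x%:C) by apply: cmeasurable_real; exact: measurable_id.
have bX : cbounded (fun x => x%:C).
  by exists 1 => x /I11P[h1 h2]; rewrite normc_real ler_norml; apply/andP; split; exact: ltW.
elim/poly_ind: p => [|p c [mp bp]].
  under eq_fun do rewrite horner0.
  by split; [exact: cmeasurable_cst|exact: cbounded_cst].
under eq_fun do rewrite hornerMXaddC; split.
  by apply: cmeasurableD; [exact: cmeasurableM|exact: cmeasurable_cst].
by apply: cboundedD; [exact: cboundedM|exact: cbounded_cst].
Qed.

Lemma cintegrable_horner (p : {poly C}) : cintegrable (fun x => p.[x%:C]).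
Proof. by have [mp bp] := tame_horner p; exact: cmeasurable_bounded_integrable. Qed.

Lemma cint1 : cint (fun=> 1 : C) = 2%:R.
Proof.
transitivity (fine (mu I) +i* 0); last by rewrite mu_I11 complexr0 rmorph_nat.
by rewrite /cint /= !Rintegral_cst// mul0r mul1r.
Qed.

Lemma cint_opp f : cintegrable f -> cint f = cint (fun x => f (- x)).
Proof.
move=> [f1 f2].
have mN : measurable_fun [set: measurableTypeR R] (-%R : _ -> measurableTypeR R).
  exact: oppr_measurable.
have NI : -%R @^-1` I = I.
  by apply/seteqP; split => x; rewrite /= => /I11P[h1 h2]; apply/I11P; split; lra.
have H (h : R -> \bar R) : mfunI h -> (forall x, (0 <= h x)%E) ->
    (\int[mu]_(x in I) h x = \int[mu]_(x in I) h (- (x : R))%R)%E.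
  move=> mh h0; rewrite -[in RHS]NI.
  rewrite -(@ge0_integral_pushforward _ _ (measurableTypeR R) (measurableTypeR R) R _ mN mu I h)//.
  apply: eq_measure_integral => A mA _; exact/esym/lebesgue_measureN.
have H2 (h : R -> R) : intble h -> \int[mu]_(x in I) h x = \int[mu]_(x in I) h (- (x : R)).
  move=> hi; have mh := measurable_int _ hi.
  congr fine; rewrite integralE [RHS]integralE; congr (_ - _)%E.
    rewrite H//; last exact: measurable_funepos.
    by apply: eq_integral => x _; rewrite !funeposE.
  rewrite H//; last exact: measurable_funeneg.
  by apply: eq_integral => x _; rewrite !funenegE.
by congr (_ +i* _); exact: H2.
Qed.

End ComplexIntegral.

(** * Dyadic expansions *)

Section Digits.
Variable R : realType.
Local Notation I := (@I11 R).
Implicit Types (x : R) (d : nat -> int).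

(** The value at 0 is a convention: the orbit of a non-dyadic point under [dbl] never meets 0. *)
Definition sgd x : int := if 0 < x then 1 else -1.

Definition dbl x : R := 2 * x - (sgd x)%:~R.

Definition greedy x (n : nat) : int := sgd (iter n dbl x).

Definition dyadic : set R := [set x | exists (k : int) (n : nat), x = k%:~R / 2 ^+ n].

Lemma countable_dyadic : countable dyadic.
Proof.
apply: (@sub_countable _ _ dyadic (range (fun p : int * nat => p.1%:~R / 2 ^+ p.2 : R))).
  apply: subset_card_le.
  by move=> x [k [n ->]]; exists (k, n).
apply: card_le_trans (card_image_le _ _) _; exact: countableP.
Qed.

Lemma sgd_pm1 x : sgd x = 1 \/ sgd x = -1.
Proof. by rewrite /sgd; case: ifP; [left|right]. Qed.

Lemma dyadic0 : dyadic 0.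
Proof. by exists 0, 0%N; rewrite mul0r. Qed.

Lemma dyadic_step x (s : int) : dyadic (2 * x - s%:~R) -> dyadic x.
Proof.
move=> [k [n e]]; exists (k + s * 2 ^+ n), n.+1.
have -> : x = (k%:~R / 2 ^+ n + s%:~R) / 2 by rewrite -e; field.
rewrite rmorphD rmorphM rmorphXn exprS.
by field; rewrite expf_neq0.
Qed.

Lemma dyadic_unstep x (s : int) : dyadic x -> dyadic (2 * x - s%:~R).
Proof.
move=> [k [n ->]]; exists (2 * k - s * 2 ^+ n), n.
by rewrite rmorphB !rmorphM rmorphXn; field; rewrite expf_neq0.
Qed.

Lemma dyadicN x : dyadic (- x) -> dyadic x.
Proof. by move=> [k [n e]]; exists (- k), n; rewrite rmorphN mulNr -e opprK. Qed.

Lemma dyadic_half_up x : dyadic (half_up x) -> dyadic x.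
Proof.
move/(dyadic_unstep 1); congr dyadic; rewrite half_upE -[1%:~R]/(1 : R).
by field.
Qed.

Lemma dyadic_half_dn x : dyadic (half_dn x) -> dyadic x.
Proof.
move/(dyadic_unstep (-1)); congr dyadic; rewrite half_dnE -[(-1)%:~R]/(-1 : R).
by field.
Qed.

Lemma dyadic_iter_dbl x n : dyadic (iter n dbl x) -> dyadic x.
Proof. by elim: n => //= n IH /dyadic_step. Qed.

Lemma dbl_bound x : `|x| <= 1 -> `|dbl x| <= 1.
Proof.
rewrite /dbl /sgd; case: ltP => x0; rewrite !ler_norml => /andP[h1 h2].
  by rewrite -[1%:~R]/(1 : R); apply/andP; split; lra.
by rewrite -[(-1)%:~R]/(-1 : R); apply/andP; split; lra.
Qed.

(** After n digits the remainder is the n-th iterate of [dbl] divided by 2^n, and the orbit stays in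
    [-1, 1]. *)
Lemma greedy_expansion x : `|x| <= 1 -> is_expansion x (greedy x).
Proof.
move=> x1; split; first by move=> n; exact: sgd_pm1.
have sE n : series (fun n => (greedy x n)%:~R / 2 ^+ n.+1 : R) n = x - iter n dbl x / 2 ^+ n.
  elim: n => [|n IH]; first by rewrite /series/= big_geq// expr0 divr1 subrr.
  rewrite seriesSr IH /= /greedy {3}/dbl exprS.
  by field; rewrite expf_neq0.
have y1 n : `|iter n dbl x| <= 1 by elim: n => //= n; exact: dbl_bound.
rewrite (_ : series _ = fun n => x - iter n dbl x / 2 ^+ n); last by apply/funext.
rewrite -[X in _ --> X]subr0; apply: cvgB; first exact: cvg_cst.
have g0 : (fun n => geometric 1 (2^-1 : R) n) @ \oo --> (0 : R).
  by apply: cvg_geometric; rewrite ger0_norm; lra.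
have g1 : (fun n => - geometric 1 (2^-1 : R) n) @ \oo --> (0 : R).
  by rewrite -[X in _ --> X]oppr0; exact: cvgN.
apply: (squeeze_cvgr _ g1 g0); near=> n.
rewrite /= mul1r -ler_norml normrM normfV [`|2 ^+ n|]ger0_norm ?exprn_ge0// exprVn.
by rewrite ler_piMl// invr_ge0 exprn_ge0.
Unshelve. all: by end_near. Qed.

Lemma is_expansionS x d : is_expansion x d -> is_expansion (2 * x - (d 0%N)%:~R) (fun n => d n.+1).
Proof.
move=> [dpm dx]; split; first by move=> n; exact: dpm.
have -> : series (fun n => (d n.+1)%:~R / 2%:R ^+ n.+1 : R) =
    fun n => 2 * series (fun n => (d n)%:~R / 2%:R ^+ n.+1 : R) n.+1 - (d 0%N)%:~R.
  apply/funext => n; rewrite /series/= big_nat_recl// mulrDr expr1.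
  have -> : 2 * ((d 0%N)%:~R / 2) = (d 0%N)%:~R :> R by field.
  rewrite addrC addKr mulr_sumr; apply: eq_bigr => k _.
  by rewrite [in RHS]exprS; field; rewrite expf_neq0.
by apply: cvgB; [apply: cvgMr; rewrite cvg_shiftS|exact: cvg_cst].
Qed.

Lemma is_expansion_bound x d : is_expansion x d -> `|x| <= 1.
Proof.
move=> [dpm dx].
set s := series _ in dx.
have cs : (fun n => `|s n|) @ \oo --> `|x| by apply: cvg_norm.
apply: (ler_cvg_to cs (cvg_cst _)); near=> n.
suff : `|series (fun n => (d n)%:~R / 2%:R ^+ n.+1 : R) n| <= 1 - 2^-1 ^+ n.
  by move=> H; rewrite (le_trans H)// gerBl exprn_ge0.
elim: (n) => [|m IH]; first by rewrite /series/= big_geq// normr0 expr0 subrr.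
rewrite seriesSr (le_trans (ler_normD _ _))//.
have -> : `|(d m)%:~R / 2%:R ^+ m.+1| = 2^-1 ^+ m.+1 :> R.
  rewrite normrM normfV [`|2 ^+ _|]ger0_norm ?exprn_ge0// exprVn.
  by case: (dpm m) => ->; rewrite ?rmorphN /= ?normrN normr1 mul1r.
by rewrite (le_trans (lerD IH (lexx _)))// exprS; lra.
Unshelve. all: by end_near. Qed.

(** The shifted digits expand 2 x - d_0, so |2 x - d_0| <= 1 and x cannot have the sign opposite to
    d_0; x = 0 is dyadic. *)
Lemma is_expansion_head x d : ~ dyadic x -> is_expansion x d -> d 0%N = sgd x.
Proof.
move=> ndx dx.
have x0 : x != 0 by apply/eqP => x0; apply: ndx; rewrite x0; exact: dyadic0.
have := is_expansion_bound (is_expansionS dx); rewrite ler_norml => /andP[h1 h2].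
case: dx => /(_ 0%N) [e|e] _; rewrite e in h1 h2 *; rewrite /sgd.
  rewrite -[1%:~R]/(1 : R) in h1 h2.
  by rewrite ifT// lt_neqAle eq_sym x0 /=; lra.
rewrite -[(-1)%:~R]/(-1 : R) in h1 h2.
by rewrite ifF//; apply/negbTE; rewrite -leNgt; lra.
Qed.

Lemma is_expansion_greedy x d : ~ dyadic x -> is_expansion x d -> d = greedy x.
Proof.
move=> ndx dx; apply/funext => n.
elim: n x d ndx dx => [|n IH] x d ndx dx; first exact: is_expansion_head.
have e := is_expansion_head ndx dx.
have := is_expansionS dx; rewrite e -[2 * x - _]/(dbl x) => dx'.
have ndx' : ~ dyadic (dbl x) by move/dyadic_step.
by rewrite (IH _ _ ndx' dx') /greedy iterSr.
Qed.

Lemma digitsE x : I x -> ~ dyadic x -> digits x = greedy x.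
Proof.
move=> /I11P[h1 h2] ndx; rewrite /digits; apply: xget_unique => /=.
  by apply: greedy_expansion; rewrite ler_norml; apply/andP; split; exact: ltW.
by move=> d; exact: is_expansion_greedy.
Qed.

Lemma dbl_half_up x : I x -> dbl (half_up x) = x.
Proof.
move=> /I11P[h1 h2]; rewrite /dbl /sgd half_upE ifT; last by lra.
by rewrite -[1%:~R]/(1 : R); field.
Qed.

Lemma dbl_half_dn x : I x -> dbl (half_dn x) = x.
Proof.
move=> /I11P[h1 h2]; rewrite /dbl /sgd half_dnE ifF; last by apply/negbTE; rewrite -leNgt; lra.
by rewrite -[(-1)%:~R]/(-1 : R); field.
Qed.

Lemma greedyS x n : greedy x n.+1 = greedy (dbl x) n.
Proof. by rewrite /greedy iterSr. Qed.

Lemma sgdN x : x != 0 -> sgd (- x) = - sgd x.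
Proof.
rewrite /sgd oppr_gt0 => x0; case: ltgtP x0 => //.
Qed.

Lemma greedyN x n : ~ dyadic x -> greedy (- x) n = - greedy x n.
Proof.
move=> ndx; have nz y m : ~ dyadic y -> iter m dbl y != 0.
  by move=> ndy; apply/eqP => e; apply: ndy; apply: (@dyadic_iter_dbl _ m); rewrite e; exact: dyadic0.
have itN m : iter m dbl (- x) = - iter m dbl x.
  elim: m => //= m ->; rewrite /dbl sgdN ?nz// rmorphN; ring.
by rewrite /greedy itN sgdN// nz.
Qed.

(** This is the gain over [digits], which comes from a choice: greedy digits are built from signs
    and affine maps. *)
Lemma measurable_greedy n :
  measurable_fun [set: measurableTypeR R] (fun x => (greedy x n)%:~R : R).
Proof.
have msg (f : measurableTypeR R -> R) : measurable_fun setT f ->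
    measurable_fun setT (fun x => (sgd (f x))%:~R : R).
  move=> mf; rewrite (_ : (fun x => _) = fun x => if 0 < f x then 1 else -1 : R).
    by apply: measurable_fun_ifT => //; apply: measurable_fun_ltr.
  by apply/funext => x; rewrite /sgd; case: ifP.
apply: (msg); elim: n => [|n IH] /=; first exact: measurable_id.
apply: measurable_funB; last exact: (msg).
by apply: measurable_funM => //; exact: measurable_cst.
Qed.

End Digits.

(** * Measurability off the dyadic rationals *)

Section NonDyadic.
Variable R : realType.
Local Notation mu := (@lebesgue_measure R).
Local Notation I := (@I11 R).
Local Notation C := R[i].
Local Notation mfunI f := (@measurable_fun _ _ (measurableTypeR R) _ I f).

Lemma measurable_dyadic : @measurable _ (measurableTypeR R) (@dyadic R).
Proof. by apply: countable_measurable; [exact: measurable_set1|exact: countable_dyadic]. Qed.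

Lemma ae11_nondyadic (f g : R -> C) :
  (forall x, I x -> ~ dyadic x -> f x = g x) -> ae11 f g.
Proof.
move=> fg; exists (@dyadic R); split.
- exact: measurable_dyadic.
- exact: countable_lebesgue_measure0 (@countable_dyadic R).
by move=> x /= fgx; apply: contrapT => ndx; apply: fgx => xI; exact: fg.
Qed.

(** Every subset of a countable set is Borel, so arbitrary values on the dyadics do no harm to
    measurability. *)
Lemma measurable_nondyadic (f g : R -> R) : mfunI g ->
  (forall x, I x -> ~ dyadic x -> f x = g x) -> mfunI f.
Proof.
move=> mg fg _ Y mY.
have -> : I `&` f @^-1` Y =
    ((I `&` g @^-1` Y) `\` @dyadic R) `|` (I `&` f @^-1` Y `&` @dyadic R).
  apply/seteqP; split => x /=.
    move=> [xI fY]; have [dx|ndx] := pselect (dyadic x); first by right.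
    by left; split => //; split => //; rewrite -fg.
  by move=> [[[xI gY] ndx]|[]//]; split => //; rewrite fg.
apply: measurableU.
  apply: measurableD; last exact: measurable_dyadic.
  exact: mg (@measurable_I11 R) _ mY.
apply: countable_measurable; first exact: measurable_set1.
by apply: sub_countable (@countable_dyadic R); apply: subset_card_le => x [].
Qed.

Lemma cmeasurable_nondyadic (f g : R -> C) : cmeasurable g ->
  (forall x, I x -> ~ dyadic x -> f x = g x) -> cmeasurable f.
Proof.
move=> [g1 g2] fg; split.
  by apply: measurable_nondyadic g1 _ => x xI ndx; rewrite fg.
by apply: measurable_nondyadic g2 _ => x xI ndx; rewrite fg.
Qed.

Lemma Lmn_greedy m n x : I x -> ~ dyadic x ->
  Lmn m n x = (\sum_(m <= j < n.+1) greedy x j == 0)%:R.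
Proof. by move=> xI ndx; rewrite /Lmn digitsE. Qed.

Lemma cmeasurable_Lmn m n : cmeasurable (@Lmn R m n).
Proof.
pose S (x : R) : R := \sum_(m <= j < n.+1) (greedy x j)%:~R.
have mS : measurable_fun [set: measurableTypeR R] S.
  rewrite /S; elim: (index_iota _ _) => [|j s IH].
    by under eq_fun do rewrite big_nil; exact: measurable_cst.
  by under eq_fun do rewrite big_cons; apply: measurable_funD => //; exact: measurable_greedy.
apply: (@cmeasurable_nondyadic _ (fun x => (\1_[set 0 : R] (S x))%:C)).
  apply: cmeasurable_real; apply: measurable_funTS.
  have m1 : measurable_fun [set: measurableTypeR R] (\1_[set (0 : R)] : measurableTypeR R -> R).
    by apply: measurable_indic; exact: measurable_set1.
  have mS' : @measurable_fun _ _ (measurableTypeR R) (measurableTypeR R) setT S := mS.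
  exact: (measurableT_comp m1 mS').
move=> x xI ndx; rewrite Lmn_greedy// indicE rmorph_nat; congr (nat_of_bool _)%:R.
rewrite /S -rmorph_sum /=; apply/idP/idP; rewrite in_setE /=.
  by move=> /eqP ->.
by move=> /eqP; rewrite intr_eq0.
Qed.

Lemma normc_nat n : Normc.normc (n%:R : C) = n%:R.
Proof. by rewrite -(rmorph_nat (real_complex R)) normc_real ger0_norm. Qed.

Lemma normc_Lmn m n x : Normc.normc (@Lmn R m n x) <= 1.
Proof. by rewrite /Lmn normc_nat; case: eqP. Qed.

End NonDyadic.

(** * The functions U and V *)

Section UV.
Variables (R : realType) (lam : R[i]).
Hypothesis lam1 : `|lam| < 1.
Local Notation mu := (@lebesgue_measure R).
Local Notation I := (@I11 R).
Local Notation C := R[i].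
Local Notation normc := (@Normc.normc R).
Local Notation U := (Ufun lam).
Local Notation V := (Vfun lam).
Local Notation l := (normc lam).

Let l0 : 0 <= l := normc_ge0 lam.
Let l1 : l < 1 := normc_lt1 lam1.

Let Vt (n : nat) (x : R) : C := lam ^+ n.+1 * Lmn 0 n x.
Let Ut (n : nat) (x : R) : C := \sum_(0 <= m < n.+1) lam ^+ n.+1 * Lmn m n x.

(** The factor [n.+1] counts the terms m <= n of the inner sum of U; the same bound serves V. *)
Let bnd (n : nat) : R := n.+1%:R * l ^+ n.

Let normc_Ut n x : normc (Ut n x) <= bnd n.
Proof.
rewrite (le_trans (normc_sum _ _ _))// /bnd.
have -> : n.+1%:R * l ^+ n = \sum_(0 <= m < n.+1) l ^+ n.
  by rewrite big_mkord sumr_const card_ord mulr_natl.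
apply: ler_sum => m _; rewrite Normc.normcM normcX -[leRHS]mulr1.
rewrite ler_pM ?exprn_ge0 ?normc_ge0 ?normc_Lmn// exprS.
by rewrite ler_piMl ?exprn_ge0// ltW.
Qed.

Let normc_Vt n x : normc (Vt n x) <= bnd n.
Proof.
rewrite /bnd /Vt Normc.normcM normcX.
have h : l ^+ n.+1 <= l ^+ n by rewrite exprS ler_piMl ?exprn_ge0// ltW.
rewrite (@le_trans _ _ (l ^+ n))//.
  by rewrite -[leRHS]mulr1 ler_pM ?exprn_ge0 ?normc_ge0 ?normc_Lmn.
by rewrite ler_peMl ?exprn_ge0// ler1n.
Qed.

Let cvg_bnd : cvgn (series bnd) := cvg_series_nat_geometric l0 l1.

Let sV x : abs_summable (Vt ^~ x).
Proof. by apply: abs_summable_le cvg_bnd => n; exact: normc_Vt. Qed.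

Let sU x : abs_summable (Ut ^~ x).
Proof. by apply: abs_summable_le cvg_bnd => n; exact: normc_Ut. Qed.

Let csum_bnd (u : nat -> C) : abs_summable u -> (forall n, normc (u n) <= bnd n) ->
  normc (csum u) <= limn (series bnd).
Proof.
by move=> su ub; rewrite (le_trans (normc_csum su))//; apply: lim_series_le.
Qed.

Lemma cmeasurable_V : cmeasurable V.
Proof.
apply: cmeasurableD; first exact: cmeasurable_cst.
apply: (cmeasurable_csum (u := Vt)) => [n|x _]; last exact: sV.
by apply: cmeasurableM; [exact: cmeasurable_cst|exact: cmeasurable_Lmn].
Qed.

Lemma cmeasurable_U : cmeasurable U.
Proof.
apply: (cmeasurable_csum (u := Ut)) => [n|x _]; last exact: sU.
rewrite /Ut; elim: (index_iota _ _) => [|j s IH].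
  by under eq_fun do rewrite big_nil; exact: cmeasurable_cst.
under eq_fun do rewrite big_cons.
by apply: cmeasurableD => //; apply: cmeasurableM; [exact: cmeasurable_cst|exact: cmeasurable_Lmn].
Qed.

Lemma cbounded_V : cbounded V.
Proof.
apply: cboundedD; first exact: cbounded_cst.
by eexists => x _; exact: (csum_bnd (@sV x) (fun n => normc_Vt n x)).
Qed.

Lemma cbounded_U : cbounded U.
Proof.
by eexists => x _; exact: (csum_bnd (@sU x) (fun n => normc_Ut n x)).
Qed.

(* Digit [0] of [y] is followed by the digits of [x]; the terms of [U y] with
   [m = 0] sum to [V y - 1]. *)
Lemma U_shift x y : I x -> ~ dyadic x -> I y -> ~ dyadic y -> dbl y = x ->
  U y = V y - 1 + lam * U x.
Proof.
move=> xI ndx yI ndy yx.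
have g n : greedy y n.+1 = greedy x n by rewrite greedyS yx.
have LS m n : Lmn m.+1 n.+1 y = Lmn m n x.
  rewrite !Lmn_greedy// big_add1 /=; congr (nat_of_bool (_ == 0))%:R.
  by apply: eq_bigr => j _; exact: g.
(* The blocks with m >= 1 avoid digit 0 of [y]; they are blocks of [x] moved by one place, whence
   the extra factor [lam]. *)
pose W (n : nat) : C := if n is k.+1 then lam * Ut k x else 0.
have UE : Ut ^~ y = fun n => Vt n y + W n.
  apply/funext => n; rewrite /Ut big_nat_recl//; congr (_ + _).
  case: n => [|n]; first by rewrite big_geq.
  rewrite /W /Ut mulr_sumr; apply: eq_bigr => m _.
  by rewrite LS exprS mulrA.
have sW : abs_summable W.
  have -> : W = fun n => Ut n y + (-1) * Vt n y.
    by apply/funext => n; rewrite [Ut n y](congr1 (@^~ n) UE); ring.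
  by apply: abs_summableD => //; exact: abs_summableZ.
rewrite /Ufun -[csum _]/(csum (Ut ^~ y)) UE csumD// (csumS sW) add0r csumZ//.
by congr (_ + _); rewrite /Vfun addrAC subrr add0r.
Qed.

Lemma U_half_up x : I x -> ~ dyadic x ->
  U (half_up x) = V (half_up x) - 1 + lam * U x.
Proof.
move=> xI ndx; apply: U_shift => //; [exact: half_up_I11| |exact: dbl_half_up].
by move/dyadic_half_up.
Qed.

Lemma U_half_dn x : I x -> ~ dyadic x ->
  U (half_dn x) = V (half_dn x) - 1 + lam * U x.
Proof.
move=> xI ndx; apply: U_shift => //; [exact: half_dn_I11| |exact: dbl_half_dn].
by move/dyadic_half_dn.
Qed.

Lemma U_opp x : I x -> ~ dyadic x -> U (- x) = U x.
Proof.
move=> xI ndx.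
have NxI : I (- x) by move: xI => /I11P[h1 h2]; apply/I11P; split; lra.
have ndNx : ~ dyadic (- x) by move/dyadicN.
congr csum; apply/funext => n; apply: eq_bigr => m _; congr (_ * _).
rewrite !Lmn_greedy//; congr (nat_of_bool _)%:R.
rewrite (eq_bigr (fun j => - greedy x j)) => [|j _]; last exact: greedyN.
by rewrite sumrN oppr_eq0.
Qed.

Lemma cintegrable_one_sub (g : R -> C) : cintegrable g -> cintegrable (one_sub_op lam g).
Proof.
move=> gi; have hi := cintegrable_half gi.
have := cintegrableD gi (cintegrableZ (- lam) hi).
by under eq_fun do rewrite mulNr.
Qed.

Lemma cint_one_sub (g : R -> C) : cintegrable g ->
  cint (one_sub_op lam g) = (1 - lam) * cint g.
Proof.
move=> gi; have hi := cintegrable_half gi.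
rewrite [LHS](cintB gi (cintegrableZ lam hi)) cintZ// -cint_fold//.
by rewrite mulrBl mul1r.
Qed.

(** Only the integral of U g is folded. Self-similarity on both branches turns it into the folded
    integral of V g - g plus lam times that of U A g, which cancels the subtracted term. *)
Lemma cint_U_one_sub (g : R -> C) : cintegrable g ->
  cint (fun x => U x * one_sub_op lam g x) =
  cint (fun x => V x * g x) - cint g.
Proof.
move=> gi; have hi := cintegrable_half gi.
have UM f := @cintegrableM _ U f cmeasurable_U cbounded_U.
have VM f := @cintegrableM _ V f cmeasurable_V cbounded_V.
pose K (f : R -> C) x := (f (half_up x) + f (half_dn x)) / 2%:R.
pose w x := V x * g x - g x.
have wi : cintegrable w.
  have := cintegrableD (VM _ gi) (cintegrableZ (-1) gi).
  by under eq_fun do rewrite mulN1r.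
have Kwi : cintegrable (K w) := cintegrable_half wi.
have UKi : cintegrable (fun x => lam * (U x * K g x)) by exact: cintegrableZ (UM _ hi).
rewrite (@eq_cint _ _ (fun x => U x * g x - lam * (U x * K g x))); last first.
  by move=> x _; rewrite /one_sub_op /K /Rplus_op /Rminus_op -/(half_up x) -/(half_dn x); ring.
rewrite cintB//; last exact: UM.
rewrite (cint_fold (UM _ gi)).
have alg (v1 v2 g1 g2 u h : C) :
    ((v1 - 1 + lam * u) * g1 + (v2 - 1 + lam * u) * g2) * h =
    ((v1 * g1 - g1) + (v2 * g2 - g2)) * h + lam * (u * ((g1 + g2) * h)) by ring.
rewrite (@ae_cint _ _ (fun x => K w x + lam * (U x * K g x))); first last.
- apply: ae11_nondyadic => x xI ndx; rewrite U_half_up// U_half_dn//; exact: alg.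
- exact: cintegrable_measurable (cintegrableD Kwi UKi).
- exact: cintegrable_measurable (cintegrable_half (UM _ gi)).
rewrite cintD// addrK -cint_fold// /w cintB//; exact: VM.
Qed.

Lemma cint_U_odd N : odd N -> cint (fun x => U x * x%:C ^+ N) = 0.
Proof.
move=> oN; have -> : cint (fun x => U x * x%:C ^+ N) =
    cint (fun x => U x * ('X^N).[x%:C]) by apply: eq_cint => x _; rewrite hornerXn.
set f := fun x => _.
have fi : cintegrable f.
  exact: cintegrableM cmeasurable_U cbounded_U (cintegrable_horner _).
have Nfi : cintegrable (fun x => (-1) * f x) by exact: cintegrableZ.
have e : cint f = cint (fun x => (-1) * f x).
  rewrite cint_opp//.
  have e x : I x -> ~ dyadic x -> f (- x) = -1 * f x.
    move=> xI ndx; rewrite /f U_opp// !hornerXn rmorphN exprNn -signr_odd oN; ring.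
  apply: ae_cint; last exact: ae11_nondyadic.
    apply: (cmeasurable_nondyadic _ e); exact: cintegrable_measurable.
  exact: cintegrable_measurable.
rewrite cintZ// in e.
have : 2%:R * cint f = 0 by rewrite mulr2n mulrDl mul1r {1}e mulN1r addNr.
by move/eqP; rewrite mulf_eq0 pnatr_eq0 /= => /eqP.
Qed.

End UV.

(** * Inverting 1 - lam A on L^2 *)

Section L2Operators.
Variables (R : realType).
Local Notation mu := (@lebesgue_measure R).
Local Notation I := (@I11 R).
Local Notation C := R[i].
Local Notation normc := (@Normc.normc R).
Local Notation mfunI f := (@measurable_fun _ _ (measurableTypeR R) _ I f).
Implicit Types (f g : R -> C) (p q : R -> R).

Let mI : @measurable _ (measurableTypeR R) I := @measurable_I11 R.

Lemma sqnormE (z : C) : sqnorm z = normc z ^+ 2.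
Proof. by rewrite /sqnorm norm_normc -rmorphXn. Qed.

Lemma sqnorm_ge0 (z : C) : 0 <= sqnorm z.
Proof. by rewrite sqnormE sqr_ge0. Qed.

Lemma sqnorm_ReIm (z : C) : sqnorm z = complex.Re z ^+ 2 + complex.Im z ^+ 2.
Proof. by rewrite sqnormE; case: z => a b /=; rewrite sqr_sqrtr// addr_ge0 ?sqr_ge0. Qed.

Lemma sqnormD (z w : C) : sqnorm (z + w) <= 2 * (sqnorm z + sqnorm w).
Proof.
rewrite !sqnorm_ReIm ReD ImD.
set a := complex.Re z; set b := complex.Re w; set c := complex.Im z; set d := complex.Im w.
rewrite -subr_ge0 (_ : _ - _ = (a - b) ^+ 2 + (c - d) ^+ 2); last by ring.
by rewrite addr_ge0 ?sqr_ge0.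
Qed.

Lemma sqnormM (z w : C) : sqnorm (z * w) = sqnorm z * sqnorm w.
Proof. by rewrite !sqnormE Normc.normcM exprMn. Qed.

Lemma measurable_sqnorm f : cmeasurable f -> mfunI (fun x => sqnorm (f x)).
Proof.
move=> [f1 f2]; under eq_fun do rewrite sqnorm_ReIm.
by apply: measurable_funD; exact: measurable_funX.
Qed.

(** Kept in the extended reals: [L2norm] goes through [fine], which sends an infinite integral to 0,
    so finiteness has to be settled first. *)
Definition energy f : \bar R := (\int[mu]_(x in I) (sqnorm (f x))%:E)%E.

Lemma energy_ge0 f : (0 <= energy f)%E.
Proof. by apply: integral_ge0 => x _; rewrite lee_fin sqnorm_ge0. Qed.

Lemma L2P f : L2 f <-> cmeasurable f /\ (energy f < +oo)%E.
Proof. by split=> [[h1 h2 h3]|[[h1 h2] h3]]; split => //; split. Qed.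

(** The interval has finite measure and |a| <= 1 + a^2. *)
Lemma L2_cintegrable f : L2 f -> cintegrable f.
Proof.
move=> /L2P[[f1 f2] fin]; have ms := measurable_sqnorm (conj f1 f2).
have H (h : R -> R) : mfunI h -> (forall x, `|h x| <= 1 + sqnorm (f x)) ->
    mu.-integrable I (EFin \o h).
  move=> mh hle; apply/integrableP; split; first exact/measurable_EFinP.
  apply: (@le_lt_trans _ _ (\int[mu]_(x in I) (1%:E + (sqnorm (f x))%:E))%E).
    apply: ge0_le_integral => //.
    - by apply/measurable_EFinP; apply: measurableT_comp.
    - by apply/measurable_EFinP; apply: measurable_funD => //; exact: measurable_cst.
    - by move=> x _; rewrite /= lee_fin.
  rewrite ge0_integralD//; last 2 first.
  - by move=> x _; rewrite lee_fin sqnorm_ge0.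
  - exact/measurable_EFinP.
  have -> : (\int[mu]_(_ in I) 1 = 2%:E)%E by rewrite integral_cst// mul1e; exact: mu_I11.
  by rewrite lte_add_pinfty ?ltry.
have le1 (a : R) : `|a| <= 1 + a ^+ 2.
  by rewrite ler_norml; apply/andP; split; nra.
split; apply: H => // x.
  by rewrite (le_trans (le1 _))// lerD2l sqnorm_ReIm lerDl sqr_ge0.
by rewrite (le_trans (le1 _))// lerD2l sqnorm_ReIm lerDr sqr_ge0.
Qed.

Lemma Rintegral_energy f : L2 f ->
  (\int[mu]_(x in I) sqnorm (f x))%:E = energy f.
Proof.
move=> /L2P[_ fin]; rewrite /Rintegral fineK// ge0_fin_numE//; exact: energy_ge0.
Qed.

Lemma L2_energy_le f g (c : R) : 0 <= c -> L2 f -> cmeasurable g ->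
  (energy g <= (c ^+ 2)%:E * energy f)%E -> L2 g /\ L2norm g <= c * L2norm f.
Proof.
move=> c0 Lf mg le.
have Lg : L2 g.
  apply/L2P; split => //; apply: le_lt_trans le _.
  by rewrite -Rintegral_energy// -EFinM ltry.
split => //; move: le; rewrite -!Rintegral_energy// -EFinM lee_fin => le.
rewrite /L2norm -[c in leRHS]ger0_norm// -sqrtr_sqr -sqrtrM ?sqr_ge0//.
by rewrite ler_wsqrtr.
Qed.

Lemma energy_lin (c : C) f g : cmeasurable f -> cmeasurable g ->
  (energy (fun x => (c * f x + g x)%R) <=
    (2 * sqnorm c)%:E * energy f + 2%:E * energy g)%E.
Proof.
move=> mf mg; rewrite /energy.
have sf := measurable_sqnorm mf; have sg := measurable_sqnorm mg.
have e1 : (0 <= 2 * sqnorm c)%R by rewrite mulr_ge0 ?sqnorm_ge0.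
rewrite -ge0_integralZl_EFin//; last 2 first.
- by move=> x _; rewrite lee_fin sqnorm_ge0.
- exact/measurable_EFinP.
rewrite -ge0_integralZl_EFin//; last 2 first.
- by move=> x _; rewrite lee_fin sqnorm_ge0.
- exact/measurable_EFinP.
have m1 : mfunI (fun x => ((2 * sqnorm c)%:E * (sqnorm (f x))%:E)%E).
  apply/measurable_EFinP; apply: measurable_funM => //; exact: measurable_cst.
have m2 : mfunI (fun x => (2%:E * (sqnorm (g x))%:E)%E).
  apply/measurable_EFinP; apply: measurable_funM => //; exact: measurable_cst.
rewrite -ge0_integralD//; last 2 first.
- by move=> x _; rewrite -EFinM lee_fin mulr_ge0 ?sqnorm_ge0.
- by move=> x _; rewrite -EFinM lee_fin mulr_ge0 ?sqnorm_ge0.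
apply: ge0_le_integral => //.
- by move=> x _; rewrite lee_fin sqnorm_ge0.
- apply/measurable_EFinP; apply: measurable_sqnorm; apply: cmeasurableD => //.
  by apply: cmeasurableM => //; exact: cmeasurable_cst.
- by apply: emeasurable_funD.
- move=> x _; rewrite -!EFinM -EFinD lee_fin (le_trans (sqnormD _ _))//.
  by rewrite sqnormM mulrDr mulrA.
Qed.

Lemma L2_lin (c : C) f g : L2 f -> L2 g -> L2 (fun x => c * f x + g x).
Proof.
move=> /L2P[mf fin] /L2P[mg gin]; apply/L2P; split.
  by apply: cmeasurableD => //; apply: cmeasurableM => //; exact: cmeasurable_cst.
apply: le_lt_trans (energy_lin _ mf mg) _.
have Lf : L2 f by apply/L2P. have Lg : L2 g by apply/L2P.
by rewrite -!Rintegral_energy// -!EFinM -EFinD ltry.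
Qed.

Definition avg_op f : R -> C := fun x => (f (half_up x) + f (half_dn x)) / 2%:R.

Definition avg_real p : R -> R := fun x => (p (half_up x) + p (half_dn x)) / 2.

Lemma one_sub_opE (lam : C) f x : one_sub_op lam f x = f x - lam * avg_op f x.
Proof. by []. Qed.

Lemma avg_op_lin (c : C) f g :
  avg_op (fun x => c * f x + g x) = fun x => c * avg_op f x + avg_op g x.
Proof. by apply/funext => x; rewrite /avg_op; ring. Qed.

Lemma iter_avg_op_lin n (c : C) f g :
  iter n avg_op (fun x => c * f x + g x) =
  fun x => c * iter n avg_op f x + iter n avg_op g x.
Proof. by elim: n => //= n ->; exact: avg_op_lin. Qed.

Lemma avg_real_ge0 p : (forall x, 0 <= p x) -> forall x, 0 <= avg_real p x.
Proof. by move=> p0 x; rewrite divr_ge0// addr_ge0. Qed.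

Lemma iter_avg_real_ge0 n p : (forall x, 0 <= p x) -> forall x, 0 <= iter n avg_real p x.
Proof. by move=> p0; elim: n => //= n IH; exact: avg_real_ge0. Qed.

(** Convexity of the squared modulus. *)
Lemma sqnorm_avg f x : sqnorm (avg_op f x) <= avg_real (fun x => sqnorm (f x)) x.
Proof.
rewrite /avg_op /avg_real sqnormM; set w := f _ + f _.
have -> : sqnorm (2%:R^-1 : C) = 4^-1.
  by rewrite half_real sqnorm_ReIm /= expr0n addr0 expr2 -invfM; congr (_^-1); ring.
have := sqnormD (f (half_up x)) (f (half_dn x)); rewrite -/w; lra.
Qed.

Lemma sqnorm_iter_avg n f x :
  sqnorm (iter n avg_op f x) <= iter n avg_real (fun x => sqnorm (f x)) x.
Proof.
elim: n x => //= n IH x; rewrite (le_trans (sqnorm_avg _ _))//.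
by rewrite ler_pM2r ?invr_gt0// lerD.
Qed.

Lemma measurable_avg_real p : mfunI p -> mfunI (avg_real p).
Proof.
move=> mp; apply: measurable_funM; last exact: measurable_cst.
by apply: measurable_funD; [exact: (measurable_fun_half_up mp)|exact: (measurable_fun_half_dn mp)].
Qed.

Lemma measurable_iter_avg_real n p : mfunI p -> mfunI (iter n avg_real p).
Proof. by move=> mp; elim: n => //= n; exact: measurable_avg_real. Qed.

Lemma cmeasurable_iter_avg n f : cmeasurable f -> cmeasurable (iter n avg_op f).
Proof. by move=> mf; elim: n => //= n; exact: cmeasurable_half. Qed.

Lemma integral_avg_real p : mfunI p -> (forall x, 0 <= p x) ->
  (\int[mu]_(x in I) (avg_real p x)%:E = \int[mu]_(x in I) (p x)%:E)%E.
Proof.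
move=> mp p0.
have mu1 : mfunI (fun x => (p (half_up x))%:E).
  by apply/measurable_EFinP; exact: (measurable_fun_half_up mp).
have md1 : mfunI (fun x => (p (half_dn x))%:E).
  by apply/measurable_EFinP; exact: (measurable_fun_half_dn mp).
rewrite [RHS]ge0_integral_fold; last 2 first.
- exact/measurable_EFinP.
- by move=> x _; rewrite lee_fin.
rewrite -ge0_integralD//; [|by move=> x _; rewrite lee_fin..].
rewrite -ge0_integralZl_EFin//; last 2 first.
- by move=> x _; rewrite -EFinD lee_fin addr_ge0.
- exact: emeasurable_funD.
by apply: eq_integral => x _; rewrite -EFinD -EFinM /avg_real mulrC.
Qed.

Lemma integral_iter_avg_real n p : mfunI p -> (forall x, 0 <= p x) ->
  (\int[mu]_(x in I) (iter n avg_real p x)%:E = \int[mu]_(x in I) (p x)%:E)%E.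
Proof.
move=> mp p0; elim: n => //= n IH; rewrite integral_avg_real//.
  exact: measurable_iter_avg_real.
exact: iter_avg_real_ge0.
Qed.

Lemma energy_avg f : cmeasurable f -> (energy (avg_op f) <= energy f)%E.
Proof.
move=> mf; have ms := measurable_sqnorm mf.
rewrite /energy -[leRHS]integral_avg_real//; last by move=> x; exact: sqnorm_ge0.
apply: ge0_le_integral => //.
- by move=> x _; rewrite lee_fin sqnorm_ge0.
- by apply/measurable_EFinP; apply: measurable_sqnorm; exact: cmeasurable_half.
- by apply/measurable_EFinP; exact: measurable_avg_real.
- by move=> x _; rewrite lee_fin sqnorm_avg.
Qed.

Let aeF : Filter (almost_everywhere mu).
Proof. exact: ae_filter_ringOfSetsType. Qed.

(** [ae11 f g] is convertible to the instance [P x := f x = g x]. *)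
Definition ae_I (P : R -> Prop) := {ae mu, forall x, I x -> P x}.

Lemma ae_I_half P : ae_I P -> ae_I (fun x => P (half_up x) /\ P (half_dn x)).
Proof.
move=> /ae_half; apply: (@filterS _ _ aeF) => x [h1 h2] xI.
by split; [apply: h1; exact: half_up_I11|apply: h2; exact: half_dn_I11].
Qed.

Lemma ae_I_and P Q : ae_I P -> ae_I Q -> ae_I (fun x => P x /\ Q x).
Proof.
move=> hP hQ; apply: (@filterS _ _ aeF _ _ _ (@filterI _ _ aeF _ _ hP hQ)) => x [h1 h2] xI.
by split; [exact: h1|exact: h2].
Qed.

Lemma ae_I_imply (P Q : R -> Prop) : (forall x, I x -> P x -> Q x) -> ae_I P -> ae_I Q.
Proof.
by move=> PQ; apply: (@filterS _ _ aeF) => x h xI; apply: PQ => //; exact: h.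
Qed.

Lemma ae_I_forall (P : nat -> R -> Prop) : (forall n, ae_I (P n)) -> ae_I (fun x => forall n, P n x).
Proof.
move=> /ae_foralln; apply: (@filterS _ _ aeF) => x h xI n; exact: h.
Qed.

(** * The Neumann series *)

Section Neumann.
Variable lam : C.
Hypothesis lam1 : `|lam| < 1.
Local Notation l := (normc lam).

Let l0 : 0 <= l := normc_ge0 lam.
Let l1 : l < 1 := normc_lt1 lam1.

Let sq f : R -> R := fun x => sqnorm (f x).

Let Hn f n x : R := l ^+ n * iter n avg_real (sq f) x.

(* By Cauchy-Schwarz this bounds |neumann f x| ^ 2, up to a constant; it has a
   finite integral because averaging preserves integrals. *)
Definition majorant f x : \bar R := (\sum_(n <oo) (Hn f n x)%:E)%E.

Let Hn_ge0 f n x : 0 <= Hn f n x.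
Proof. by rewrite mulr_ge0 ?exprn_ge0// iter_avg_real_ge0// => y; exact: sqnorm_ge0. Qed.

Lemma majorant_ge0 f x : (0 <= majorant f x)%E.
Proof. by apply: nneseries_ge0 => n _ _; rewrite lee_fin. Qed.

Let measurable_Hn f n : cmeasurable f -> mfunI (fun x => (Hn f n x)%:E).
Proof.
move=> mf; apply/measurable_EFinP; apply: measurable_funM; first exact: measurable_cst.
by apply: measurable_iter_avg_real; exact: measurable_sqnorm.
Qed.

Lemma measurable_majorant f : cmeasurable f -> mfunI (majorant f).
Proof.
move=> mf; apply: (@ge0_emeasurable_sum _ (measurableTypeR R) R I (fun n x => (Hn f n x)%:E) xpredT).
  by move=> n x _ _; rewrite lee_fin.
by move=> n _; exact: measurable_Hn.
Qed.

Lemma sum_geometric_le n : \sum_(0 <= k < n) l ^+ k <= (1 - l)^-1.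
Proof.
have e : (1 - l) * \sum_(0 <= k < n) l ^+ k = 1 - l ^+ n.
  elim: n => [|n IH]; first by rewrite big_geq// mulr0 expr0 subrr.
  by rewrite big_nat_recr//= mulrDr IH exprS; ring.
rewrite -[leRHS]mul1r ler_pdivlMr ?subr_gt0// mulrC e gerBl exprn_ge0//.
Qed.

(** Each average of |f|^2 has the integral of |f|^2, so only the geometric weights are summed. *)
Lemma integral_majorant f : L2 f ->
  (\int[mu]_(x in I) majorant f x <= ((1 - l)^-1)%:E * energy f)%E.
Proof.
move=> Lf; have /L2P[mf _] := Lf.
rewrite integral_nneseries//; last 2 first.
- by move=> n; exact: measurable_Hn.
- by move=> n x _; rewrite lee_fin.
have HE n : (\int[mu]_(x in I) (Hn f n x)%:E = (l ^+ n)%:E * energy f)%E.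
  have <- : (\int[mu]_(x in I) (iter n avg_real (sq f) x)%:E = energy f)%E.
    apply: integral_iter_avg_real; first exact: measurable_sqnorm.
    by move=> x; exact: sqnorm_ge0.
  rewrite -ge0_integralZl_EFin ?exprn_ge0//.
  - by move=> x _; rewrite lee_fin iter_avg_real_ge0// => y; exact: sqnorm_ge0.
  - by apply/measurable_EFinP; apply: measurable_iter_avg_real; exact: measurable_sqnorm.
apply: lime_le; first by apply: is_cvg_nneseries => n _ _; apply: integral_ge0 => x _; rewrite lee_fin.
apply: nearW => n.
under eq_bigr do rewrite HE.
rewrite -Rintegral_energy//.
under eq_bigr do rewrite -EFinM.
rewrite sumEFin -EFinM lee_fin -mulr_suml ler_wpM2r ?sum_geometric_le//.
by apply: Rintegral_ge0 => x _; exact: sqnorm_ge0.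
Qed.

Lemma majorant_fin f : L2 f -> ae_I (fun x => (majorant f x < +oo)%E).
Proof.
move=> Lf; have /L2P[mf fin] := Lf.
have int : mu.-integrable I (majorant f).
  apply/integrableP; split; first exact: measurable_majorant.
  under eq_integral => x _ do rewrite gee0_abs ?majorant_ge0//.
  by apply: le_lt_trans (integral_majorant Lf) _; rewrite -Rintegral_energy// -EFinM ltry.
have := integrable_ae mI int; apply: (@filterS _ _ aeF) => x h xI.
by have := h xI; rewrite ge0_fin_numE// majorant_ge0.
Qed.

Let term f n x : C := lam ^+ n * iter n avg_op f x.

Let normc_term_le f n x : normc (term f n x) <= l ^+ n + Hn f n x.
Proof.
rewrite /term Normc.normcM normcX /Hn -[X in _ <= X + _]mulr1 -mulrDr ler_wpM2l ?exprn_ge0//.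
have := sqnorm_iter_avg n f x; rewrite sqnormE -/(sq f).
by have := normc_ge0 (iter n avg_op f x); set y := normc _; nra.
Qed.

Lemma abs_summable_term f x : (majorant f x < +oo)%E -> abs_summable (term f ^~ x).
Proof.
move=> h; apply: (abs_summable_le (v := fun n => l ^+ n + Hn f n x)).
  by move=> n; exact: normc_term_le.
apply: is_cvg_seriesD.
  have := @is_cvg_geometric_series R 1 l; rewrite ger0_norm// => /(_ l1).
  by rewrite -exprn_geometric.
exact: nnseries_is_cvg.
Qed.

(* The coefficient in front makes the series converge for every [x]. *)
Definition neumann f : R -> C := fun x =>
  csum (fun n => (majorant f x < +oo)%E%:R * (lam ^+ n * iter n avg_op f x)).

Lemma neumannE f x : (majorant f x < +oo)%E -> neumann f x = csum (term f ^~ x).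
Proof. by move=> h; congr csum; apply/funext => n; rewrite h mul1r. Qed.

Lemma neumannN f x : ~ (majorant f x < +oo)%E -> neumann f x = 0.
Proof.
move=> /negP/negbTE h; rewrite /neumann h; apply: csum_unique.
rewrite [X in X @ _](_ : _ = fun=> 0 : C^o); first exact: cvg_cst.
by apply/funext => n; rewrite /series/= big1// => k _; rewrite mul0r.
Qed.

Lemma cmeasurable_neumann f : cmeasurable f -> cmeasurable (neumann f).
Proof.
move=> mf; apply: (cmeasurable_csum (u := fun n x => _ * (_ * _))) => [n|x xI].
  apply: cmeasurableM; last first.
    by apply: cmeasurableM; [exact: cmeasurable_cst|exact: cmeasurable_iter_avg].
  have e : (fun x => (majorant f x < +oo)%E%:R : C) =
      fun x => ((if (majorant f x < +oo)%E then 1 else 0) : R)%:C.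
    by apply/funext => x; case: ifP => _; rewrite ?rmorph1 ?rmorph0.
  rewrite e; apply: cmeasurable_real.
  apply: measurable_fun_if => //; try exact: measurable_cst.
  apply: (@measurable_fun_bool _ (measurableTypeR R) I _ true).
  have := emeasurable_fun_infty_o mI (measurable_majorant mf) +oo%E.
  by congr measurable.
have [h|h] := boolP (majorant f x < +oo)%E.
  by under eq_fun do rewrite mul1r; exact: abs_summable_term.
apply: (abs_summable_le (v := fun=> 0)) => [n|].
  by rewrite mul0r Normc.normc0.
rewrite (_ : series _ = fun=> 0); first exact: is_cvg_cst.
by apply/funext => n; rewrite /series/= big1.
Qed.

(** Cauchy-Schwarz with weights |lam|^n: the square of the sum of |lam|^n |A^n f| is at most the sum
    of the weights times the sum of |lam|^n |A^n f|^2, and |A^n f|^2 is at most the n-th average of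
    |f|^2. *)
Lemma sqnorm_neumann f x :
  ((sqnorm (neumann f x))%:E <= ((1 - l)^-1)%:E * majorant f x)%E.
Proof.
have [h|h] := boolP (majorant f x < +oo)%E; last first.
  rewrite neumannN; last exact/negP.
  rewrite sqnormE Normc.normc0 expr0n mule_ge0 ?majorant_ge0//.
  by rewrite lee_fin invr_ge0 subr_ge0 ltW.
rewrite neumannE//; have su := abs_summable_term h.
have fin : majorant f x \is a fin_num by rewrite ge0_fin_numE// majorant_ge0.
rewrite -(fineK fin) -EFinM lee_fin; set M := fine _.
have HM n : \sum_(0 <= k < n) Hn f k x <= M.
  rewrite -lee_fin /M fineK// -sumEFin; apply: nneseries_lim_ge => k _ _.
  by rewrite lee_fin.
have M0 : 0 <= M by rewrite (le_trans _ (HM 0%N))// big_geq.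
have L0 : 0 <= (1 - l)^-1 by rewrite invr_ge0 subr_ge0 ltW.
suff : normc (csum (term f ^~ x)) <= Num.sqrt ((1 - l)^-1 * M).
  move=> H; rewrite sqnormE -[leRHS]sqr_sqrtr ?mulr_ge0//.
  by rewrite lerXn2r ?nnegrE ?normc_ge0 ?sqrtr_ge0.
apply: le_trans (normc_csum su) _; apply: limr_le => //; apply: nearW => n.
rewrite -[leLHS]ger0_norm; last by apply: sumr_ge0 => k _; exact: normc_ge0.
rewrite -sqrtr_sqr ler_wsqrtr//.
pose a k := normc (iter k avg_op f x).
pose A := \sum_(0 <= k < n) l ^+ k; pose B := \sum_(0 <= k < n) l ^+ k * a k.
pose D := \sum_(0 <= k < n) l ^+ k * a k ^+ 2.
have -> : series (fun n => normc (term f n x)) n = B.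
  by rewrite /series/=; apply: eq_bigr => k _; rewrite Normc.normcM normcX.
have DM : D <= M.
  apply: le_trans (HM n); apply: ler_sum => k _; rewrite ler_wpM2l ?exprn_ge0//.
  by rewrite /a -sqnormE; exact: sqnorm_iter_avg.
have D0 : 0 <= D by apply: sumr_ge0 => k _; rewrite mulr_ge0 ?exprn_ge0// normc_ge0.
have A0 : 0 <= A by apply: sumr_ge0 => k _; rewrite exprn_ge0.
(* Cauchy-Schwarz by the discriminant of this polynomial in [t]. *)
have key t : 0 <= D - 2 * t * B + t ^+ 2 * A.
  have -> : D - 2 * t * B + t ^+ 2 * A = \sum_(0 <= k < n) l ^+ k * (a k - t) ^+ 2.
    rewrite /A /B /D !mulr_sumr -sumrB -big_split /=; apply: eq_bigr => k _; ring.
  by apply: sumr_ge0 => k _; apply: mulr_ge0; [exact: exprn_ge0|exact: sqr_ge0].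
have BA : B ^+ 2 <= A * D.
  have [A00|An0] := eqVneq A 0.
    have : B = 0.
      apply/eqP; rewrite /B big_nat big1// => k kn.
      suff -> : l ^+ k = 0 by rewrite mul0r.
      apply/eqP; rewrite eq_le exprn_ge0// andbT -A00 /A big_mkord.
      have kn' : (k < n)%N by case/andP: kn.
      by rewrite (bigD1 (Ordinal kn'))//= lerDl sumr_ge0// => i _; rewrite exprn_ge0.
    by move=> ->; rewrite expr0n A00 mul0r.
  (* The minimum of the quadratic is at t = B / A. *)
  have := key (B / A).
  have -> : D - 2 * (B / A) * B + (B / A) ^+ 2 * A = D - B ^+ 2 / A by field.
  by rewrite subr_ge0 ler_pdivrMr ?lt_neqAle 1?eq_sym ?An0// mulrC.
apply: le_trans BA _; apply: ler_pM => //; exact: sum_geometric_le.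
Qed.

(** One factor 1 / (1 - |lam|) comes from Cauchy-Schwarz, the other from integrating the
    majorant. *)
Lemma energy_neumann f : L2 f ->
  (energy (neumann f) <= (((1 - l)^-1) ^+ 2)%:E * energy f)%E.
Proof.
move=> Lf; have /L2P[mf fin] := Lf.
have L0 : 0 <= (1 - l)^-1 by rewrite invr_ge0 subr_ge0 ltW.
apply: (@le_trans _ _ (\int[mu]_(x in I) (((1 - l)^-1)%:E * majorant f x))%E).
  apply: ge0_le_integral => //.
  - by move=> x _; rewrite lee_fin sqnorm_ge0.
  - by apply/measurable_EFinP; apply: measurable_sqnorm; exact: cmeasurable_neumann.
  - by apply: emeasurable_funM; [exact: measurable_cst|exact: measurable_majorant].
  - by move=> x _; exact: sqnorm_neumann.
rewrite ge0_integralZl_EFin//; last 2 first.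
- by move=> x _; exact: majorant_ge0.
- exact: measurable_majorant.
rewrite expr2 EFinM -muleA lee_wpmul2l ?lee_fin//; exact: integral_majorant.
Qed.

Lemma ae11_avg f g : ae11 f g -> ae11 (avg_op f) (avg_op g).
Proof.
move=> fg; have := @ae_I_half (fun x => f x = g x) fg.
by apply: ae_I_imply => x _ [h1 h2]; rewrite /avg_op h1 h2.
Qed.

(** Null sets pull back to null sets along both branches, so almost everywhere all iterates agree,
    and the majorants too, hence also the cut-off where they are infinite. *)
Lemma ae_neumann f g : ae11 f g -> ae11 (neumann f) (neumann g).
Proof.
move=> fg.
have h1 n : ae_I (fun x => iter n avg_op f x = iter n avg_op g x).
  by elim: n => //= n IH; exact: ae11_avg.
have h2 n : ae_I (fun x => iter n avg_real (sq f) x = iter n avg_real (sq g) x).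
  elim: n => [|n IH] /=.
    by move: fg; apply: ae_I_imply => x _ /= e; rewrite /sq e.
  by move: (ae_I_half IH); apply: ae_I_imply => x _ [e1 e2]; rewrite /avg_real e1 e2.
move: (ae_I_and (ae_I_forall h1) (ae_I_forall h2)); apply: ae_I_imply => x _ [e1 e2].
have eM : majorant f x = majorant g x by apply: eq_eseriesr => n _; rewrite /Hn e2.
by rewrite /neumann eM; congr csum; apply/funext => n; rewrite e1.
Qed.

Lemma neumann_lin (c : C) f g : L2 f -> L2 g ->
  ae11 (neumann (fun x => c * f x + g x)) (fun x => c * neumann f x + neumann g x).
Proof.
move=> Lf Lg.
have := ae_I_and (majorant_fin (L2_lin c Lf Lg)) (ae_I_and (majorant_fin Lf) (majorant_fin Lg)).
apply: ae_I_imply => x _ [h [hf hg]]; rewrite !neumannE//.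
have sf := abs_summable_term hf; have sg := abs_summable_term hg.
rewrite -csumZ// -csumD//; last exact: abs_summableZ.
congr csum; apply/funext => n; rewrite /term iter_avg_op_lin; ring.
Qed.

Lemma L2_neumann f : L2 f -> L2 (neumann f) /\ L2norm (neumann f) <= (1 - l)^-1 * L2norm f.
Proof.
move=> Lf; have /L2P[mf _] := Lf; apply: L2_energy_le => //.
- by rewrite invr_ge0 subr_ge0 ltW.
- exact: cmeasurable_neumann.
- exact: energy_neumann.
Qed.

Lemma L2_avg f : L2 f -> L2 (avg_op f).
Proof.
move=> /L2P[mf fin]; apply/L2P; split; first exact: cmeasurable_half.
by apply: le_lt_trans fin; exact: energy_avg.
Qed.

Lemma one_sub_op_lin f : one_sub_op lam f = fun x => (- lam) * avg_op f x + f x.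
Proof. by apply/funext => x; rewrite one_sub_opE mulNr addrC. Qed.

Lemma L2_one_sub f : L2 f -> L2 (one_sub_op lam f).
Proof. by move=> Lf; rewrite one_sub_op_lin; apply: L2_lin => //; exact: L2_avg. Qed.

Theorem L2_bounded_one_sub : L2_bounded_op (one_sub_op lam).
Proof.
split.
- exact: L2_one_sub.
- move=> f g _ _ fg; move: (ae_I_and fg (ae11_avg fg)).
  by apply: ae_I_imply => x _ [e1 e2]; rewrite !one_sub_opE e1 e2.
- move=> c f g _ _; apply: aeW => x _; rewrite !one_sub_opE avg_op_lin; ring.
(* The constant: |z + w|^2 <= 2 |z|^2 + 2 |w|^2, |lam| < 1 and A a contraction give 2 + 2 = 2^2. *)
exists 2 => f Lf; have /L2P[mf fin] := Lf.
have := @L2_energy_le f (one_sub_op lam f) 2; case => //.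
  by rewrite one_sub_op_lin; apply: cmeasurableD => //; apply: cmeasurableM;
    [exact: cmeasurable_cst|exact: cmeasurable_half].
rewrite one_sub_op_lin.
apply: le_trans (energy_lin _ (cmeasurable_half mf) mf) _.
have e1 : (0 <= energy f)%E := energy_ge0 f.
have e2 : sqnorm (- lam) <= 1 by rewrite sqnormE normcN expr_le1// ltW.
have -> : ((2 ^+ 2)%:E * energy f = 2%:E * energy f + 2%:E * energy f)%E.
  by rewrite -ge0_muleDl ?lee_fin// -EFinD; congr (_%:E * _)%E; ring.
rewrite leeD2r//.
apply: (@le_trans _ _ (2%:E * energy (avg_op f))%E).
  rewrite lee_wpmul2r ?energy_ge0// lee_fin; lra.
by rewrite lee_wpmul2l ?lee_fin// energy_avg.
Qed.

Theorem L2_inverse_neumann : L2_inverse (one_sub_op lam) neumann.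
Proof.
split.
  split.
  - by move=> f /L2_neumann[].
  - by move=> f g _ _; exact: ae_neumann.
  - by move=> c f g; exact: neumann_lin.
  - by exists (1 - l)^-1 => f /L2_neumann[].
move=> f Lf; split.
  have := ae_I_and (majorant_fin Lf) (majorant_fin (L2_one_sub Lf)).
  apply: ae_I_imply => x _ [h hA]; rewrite neumannE//.
  have su := abs_summable_term h.
  (* The series telescopes to its term of index 0, which is [f x]. *)
  have e : term (one_sub_op lam f) ^~ x = fun n => term f n x + (-1) * term f n.+1 x.
    apply/funext => n; rewrite /term one_sub_op_lin iter_avg_op_lin -iterSr exprS; ring.
  have sS := abs_summableS su.
  rewrite e csumD//; last exact: abs_summableZ.
  rewrite csumZ// (csumS su) mulN1r addrK /term expr0 mul1r//.
have hf := majorant_fin Lf.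
(* Applying A to the sum evaluates it at both half points, where the majorant must be finite as
   well. *)
have := ae_I_and hf (ae_I_half hf); apply: ae_I_imply => x _ [h [hu hd]].
have su := abs_summable_term h.
have suu := abs_summable_term hu; have sud := abs_summable_term hd.
rewrite one_sub_opE /avg_op !neumannE// (csumS su).
have -> : csum (fun n => term f n.+1 x) =
    lam * ((csum (term f ^~ (half_up x)) + csum (term f ^~ (half_dn x))) / 2%:R).
  rewrite -csumD// [_ / _]mulrC -csumZ; last exact: abs_summableD.
  rewrite -csumZ; last by apply: abs_summableZ; exact: abs_summableD.
  congr csum; apply/funext => n; rewrite /term /= /avg_op exprS; ring.
by rewrite addrK /term expr0 mul1r.
Qed.

End Neumann.

End L2Operators.

(** * Moments and determinants *)

Section PolynomialMoments.
Variable R : realType.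
Local Notation C := R[i].
Local Notation P := (@Ppoly R).

Lemma cint_horner_sum k (c : 'I_k -> C) (g : 'I_k -> {poly C}) :
  cint (fun x => (\sum_(i < k) c i *: g i).[x%:C]) =
  \sum_(i < k) c i * cint (fun x => (g i).[x%:C]).
Proof.
elim: k c g => [|k IH] c g.
  rewrite !big_ord0 -[RHS](mul0r (cint (fun x => (0 : {poly C}).[x%:C]))) -cintZ.
    by apply: eq_cint => x _; rewrite horner0 mul0r.
  exact: cintegrable_horner.
rewrite !big_ord_recr /= -IH -cintZ; last exact: cintegrable_horner.
rewrite -cintD; first by apply: eq_cint => x _; rewrite hornerD hornerZ.
  exact: cintegrable_horner.
by apply: cintegrableZ; exact: cintegrable_horner.
Qed.

Lemma Ppoly0 : P 0%N = 1.
Proof.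
by have := @Xn_Ppoly R 0 isT; rewrite big_ord1 expr0 muln0 bin0 divr1 scale1r => <-.
Qed.

(** Averaging preserves the integral and multiplies P_n by 2^-n, which differs from 1 for n > 0. *)
Lemma cint_Ppoly n : cint (fun x => (P n).[x%:C]) = 2%:R * (n == 0%N)%:R.
Proof.
have [->|n0] := eqVneq n 0%N.
  by rewrite Ppoly0 mulr1 -[RHS]cint1; apply: eq_cint => x _; rewrite hornerC.
have ci := cintegrable_horner (P n).
have := cint_fold ci.
have -> : cint (fun x => ((P n).[(half_up x)%:C] + (P n).[(half_dn x)%:C]) / 2%:R) =
    (2%:R ^+ n)^-1 * cint (fun x => (P n).[x%:C]).
  rewrite -cintZ//; apply: eq_cint => x _; rewrite -Ppoly_avg.
  by rewrite /half_up /half_dn !rmorphM fmorphV rmorphD rmorphB rmorph1 rmorph_nat.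
set z := cint _ => e; rewrite mulr0; apply/eqP.
have : (2%:R ^+ n - 1) * z = 0 by rewrite mulrBl mul1r {1}e mulrA divff ?mul1r ?subrr// expf_neq0// pnatr_eq0.
move/eqP; rewrite mulf_eq0 => /orP[|//].
by rewrite subr_eq0 -natrX (eqr_nat _ _ 1) -{2}(expn0 2) eqn_exp2l// (negbTE n0).
Qed.

(** In the expansion of x^N along the P_n, only the P_0 term, at j = N/2, has a nonzero integral. *)
Lemma cint_Xn N : ~~ odd N ->
  cint (fun x : R => 'X^N.[x%:C]) = 2%:R / (N + 1)%:R.
Proof.
move=> eN; have N2 : (2 * N./2)%N = N by rewrite mul2n even_halfK.
rewrite Xn_Ppoly// cint_horner_sum big_ord_recr /= N2 big1 ?add0r => [|j _].
  by rewrite cint_Ppoly subnn binn mulr1 mul1r mulrC.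
rewrite cint_Ppoly (_ : (_ == _) = false) ?mulr0//.
by apply/negbTE; have := ltn_ord j; rewrite -{2}N2; lia.
Qed.

Lemma sum_ord_even (A : nmodType) k (F : nat -> A) :
  \sum_(i < (2 * k).+1 | ~~ odd i) F i = \sum_(j < k.+1) F (2 * j)%N.
Proof.
elim: k => [|k IH]; first by rewrite big_mkcond !big_ord1.
rewrite [RHS]big_ord_recr -IH mulnS add2n 2!big_mkcond /= 2!big_ord_recr /=.
by rewrite mul2n odd_double /= addr0 -big_mkcond.
Qed.

Lemma even_power_avg n (x : C) :
  ((x + 1) ^+ (2 * n) + (x - 1) ^+ (2 * n)) / 2%:R =
  \sum_(m < n.+1) 'C(2 * n, 2 * m)%:R * x ^+ (2 * m).
Proof.
rewrite -(@sum_ord_even _ n (fun i => 'C(2 * n, i)%:R * x ^+ i)).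
have -> : (x - 1) ^+ (2 * n) = (1 - x) ^+ (2 * n) by rewrite -opprB exprM sqrrN -exprM.
rewrite [x + 1]addrC !exprDn -big_split /= mulr_suml [RHS]big_mkcond /=.
apply: eq_bigr => i _; rewrite !expr1n !mul1r exprNn -signr_odd.
have h : 2%:R != 0 :> C by rewrite pnatr_eq0.
case: (odd i) => /=; first by rewrite mulN1r mulNrn subrr mul0r.
by rewrite expr0 mul1r -mulr2n -[_ *+ 2]mulr_natr mulfK// mulr_natl.
Qed.

End PolynomialMoments.

(** * Integrals of U against L^2 functions and polynomials *)

Section Moments.
Variables (R : realType) (lam : R[i]).
Hypothesis lam1 : `|lam| < 1.
Local Notation C := R[i].
Local Notation V := (Vfun lam).
Local Notation U := (Ufun lam).
Local Notation P := (@Ppoly R).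
Implicit Types (p q : {poly C}) (f : R -> C).

(** Take g = S f in [cint_U_one_sub]: (1 - lam A) g is f almost everywhere, and its integral is (1 -
    lam) times that of g. *)
Lemma L2_inverse_cint_U (S : (R -> C) -> R -> C) f :
  L2_inverse (one_sub_op lam) S -> L2 f ->
  cint (fun x => U x * f x) =
  cint (fun x => V x * S f x) - (1 - lam)^-1 * cint f.
Proof.
move=> [[S2 _ _ _] SA] Lf; have Lg := S2 _ Lf; have [_ e] := SA _ Lf.
have cg := L2_cintegrable Lg; have cf := L2_cintegrable Lf.
have cA := cintegrable_one_sub lam cg.
have mU := cmeasurable_U lam1.
have -> : cint (fun x => U x * f x) = cint (fun x => U x * one_sub_op lam (S f) x).
  apply: ae_cint.
  - by apply: cmeasurableM => //; exact: cintegrable_measurable.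
  - by apply: cmeasurableM => //; exact: cintegrable_measurable.
  - by apply: ae_I_imply e => x _ ->.
have -> : cint f = cint (one_sub_op lam (S f)).
  apply: ae_cint; try exact: cintegrable_measurable.
  by apply: ae_I_imply e => x _ ->.
rewrite cint_U_one_sub// cint_one_sub// mulKf// subr_eq0 eq_sym.
by apply: contraTneq lam1 => ->; rewrite normr1 ltxx.
Qed.

(** Otherwise [lam] would be [c ^ n], of modulus at least 1. The bases 2 and 4 occur in the
    formulas, and [c = 1] gives [1 - lam]. *)
Lemma one_sub_div_neq0 (c : nat) n : (0 < c)%N -> 1 - lam / c%:R ^+ n != 0.
Proof.
move=> c0; rewrite subr_eq0 eq_sym; apply: contraTneq lam1 => e.
have cn : c%:R ^+ n != 0 :> C by rewrite expf_neq0// pnatr_eq0 -lt0n.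
have -> : lam = c%:R ^+ n by rewrite -[LHS](divfK cn) e mul1r.
by rewrite -natrX normr_nat ltrn1 -leqNgt expn_gt0 c0.
Qed.

Lemma one_sub_neq0 : 1 - lam != 0.
Proof. by have := @one_sub_div_neq0 1 0 isT; rewrite expr0 divr1. Qed.

Lemma one_sub_op_horner p x : one_sub_op lam (fun x => p.[x%:C]) x =
  p.[x%:C] - lam * ((p.[(x%:C + 1) / 2%:R] + p.[(x%:C - 1) / 2%:R]) / 2%:R).
Proof.
rewrite /one_sub_op /Rplus_op /Rminus_op.
by rewrite !rmorphM fmorphV rmorphD rmorphB rmorph1 rmorph_nat.
Qed.

Lemma one_sub_op_Ppoly n x :
  one_sub_op lam (fun x => (P n).[x%:C]) x = (1 - lam / 2%:R ^+ n) * (P n).[x%:C].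
Proof. by rewrite one_sub_op_horner Ppoly_avg mulrBl mul1r mulrA. Qed.

(** For polynomials the equation (1 - lam A) q = p is solved exactly, at every point, by the
    explicit polynomials constructed below. *)
Lemma cint_U_horner p q :
  (forall x, one_sub_op lam (fun x => q.[x%:C]) x = p.[x%:C]) ->
  cint (fun x => U x * p.[x%:C]) =
  cint (fun x => V x * q.[x%:C]) - cint (fun x => p.[x%:C]) / (1 - lam).
Proof.
move=> Aq; have ci := cintegrable_horner q.
rewrite -(@eq_cint _ (one_sub_op lam (fun x => q.[x%:C])) (fun x => p.[x%:C])); last by move=> x _; exact: Aq.
rewrite cint_one_sub// [X in _ - X]mulrC mulKf ?one_sub_neq0// -cint_U_one_sub//.
by apply: eq_cint => x _; rewrite Aq.
Qed.

Lemma cintegrable_V_horner q : cintegrable (fun x => V x * q.[x%:C]).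
Proof.
by apply: cintegrableM; [exact: cmeasurable_V|exact: cbounded_V|exact: cintegrable_horner].
Qed.

Lemma cint_V_horner_sum k (c : 'I_k -> C) (g : 'I_k -> {poly C}) :
  cint (fun x => V x * (\sum_(i < k) c i *: g i).[x%:C]) =
  \sum_(i < k) c i * cint (fun x => V x * (g i).[x%:C]).
Proof.
elim: k c g => [|k IH] c g.
  rewrite !big_ord0 -[RHS](mul0r (cint (fun x => V x * (0 : {poly C}).[x%:C]))) -cintZ.
    by apply: eq_cint => x _; rewrite horner0 mulr0 mul0r.
  exact: cintegrable_V_horner.
rewrite !big_ord_recr /= -IH -cintZ; last exact: cintegrable_V_horner.
rewrite -cintD; first by apply: eq_cint => x _; rewrite hornerD hornerZ mulrDr [c _ * _]mulrCA.
  exact: cintegrable_V_horner.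
by apply: cintegrableZ; exact: cintegrable_V_horner.
Qed.

Lemma cint_U_Ppoly n :
  cint (fun x => U x * (P n).[x%:C]) =
  (1 - lam / 2%:R ^+ n)^-1 * cint (fun x => V x * (P n).[x%:C]) -
  2%:R * (n == 0%N)%:R / (1 - lam).
Proof.
have nz : 1 - lam / 2%:R ^+ n != 0 by exact: one_sub_div_neq0.
rewrite (@cint_U_horner _ ((1 - lam / 2%:R ^+ n)^-1 *: P n)) => [|x].
  rewrite cint_Ppoly -cintZ; last exact: cintegrable_V_horner.
  by congr (_ - _); apply: eq_cint => x _; rewrite hornerZ mulrCA.
have -> : (fun x : R => ((1 - lam / 2%:R ^+ n)^-1 *: P n).[x%:C]) =
    fun x => (1 - lam / 2%:R ^+ n)^-1 * (P n).[x%:C].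
  by apply/funext => y; rewrite hornerZ.
have -> (c : C) f : one_sub_op lam (fun x => c * f x) x = c * one_sub_op lam f x.
  by rewrite /one_sub_op /Rplus_op /Rminus_op; ring.
by rewrite one_sub_op_Ppoly mulKf.
Qed.

Lemma one_sub_op_horner_sum k (c : 'I_k -> C) (g : 'I_k -> {poly C}) x :
  one_sub_op lam (fun x => (\sum_(i < k) c i *: g i).[x%:C]) x =
  \sum_(i < k) c i * one_sub_op lam (fun x => (g i).[x%:C]) x.
Proof.
rewrite one_sub_op_horner !horner_sum -big_split /= mulr_suml mulr_sumr -sumrB.
by apply: eq_bigr => i _; rewrite one_sub_op_horner !hornerZ; ring.
Qed.

(** Q_N is the expansion of x^N along the P_n with each coefficient divided by the eigenvalue of 1 -
    lam A. *)
Lemma one_sub_op_Qpoly N x : ~~ odd N ->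
  one_sub_op lam (fun x => (Qpoly lam N).[x%:C]) x = 'X^N.[x%:C].
Proof.
move=> eN; rewrite one_sub_op_horner_sum Xn_Ppoly// horner_sum.
apply: eq_bigr => j _; rewrite one_sub_op_Ppoly [RHS]hornerZ mulrA; congr (_ * _).
have nz : 1 - lam / 2%:R ^+ (N - 2 * j) != 0 by exact: one_sub_div_neq0.
by rewrite invfM [_^-1 * _]mulrC mulrA mulfVK.
Qed.

Lemma cint_U_Xn N : ~~ odd N ->
  cint (fun x => U x * x%:C ^+ N) =
  cint (fun x => V x * (Qpoly lam N).[x%:C]) - 2%:R / ((1 - lam) * (N + 1)%:R).
Proof.
move=> eN; have := cint_U_horner (fun x => one_sub_op_Qpoly x eN).
rewrite cint_Xn// [X in _ = _ - X](_ : _ = 2%:R / ((1 - lam) * (N + 1)%:R)).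
  by move=> <-; apply: eq_cint => x _; rewrite hornerXn.
by rewrite [(1 - lam) * _]mulrC invfM mulrA.
Qed.

Lemma one_sub_op_even_power n (x : R) :
  one_sub_op lam (fun x => 'X^(2 * n).[x%:C]) x =
  'X^(2 * n).[x%:C] -
  \sum_(m < n.+1) lam * 'C(2 * n, 2 * m)%:R / 2%:R ^+ (2 * n) * 'X^(2 * m).[x%:C].
Proof.
rewrite one_sub_op_horner !hornerXn !expr_div_n -mulrDl [_ / 2%:R]mulrAC even_power_avg.
rewrite mulr_suml mulr_sumr; congr (_ - _); apply: eq_bigr => m _.
by rewrite hornerXn !mulrA [RHS]mulrAC.
Qed.

End Moments.

(** * Bordered determinants and even polynomials *)

Lemma det_cast (A : comPzRingType) n m (e : n = m) (M : 'M[A]_m) :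
  \det (\matrix_(i, j) M (cast_ord e i) (cast_ord e j)) = \det M.
Proof. by case: _ / e M => M; congr determinant; apply/matrixP => i j; rewrite mxE !cast_ord_id. Qed.

(** Subtracting [q] times the upper rows from the last row clears its left part and leaves the
    corner [- q v]. *)
Lemma det_bordered (A : comPzRingType) k (T : 'M[A]_k) (v : 'cV_k) (q : 'rV_k) :
  \det (block_mx T v (q *m T) 0) = - (\det T * (q *m v) 0 0).
Proof.
have -> : block_mx T v (q *m T) 0 = block_mx 1%:M 0 q 1%:M *m block_mx T v 0 (- (q *m v)).
  by rewrite mulmx_block !mul1mx !mul0mx !addr0 subrr.
by rewrite det_mulmx det_lblock det_ublock !det1 mul1r mul1r det_mx11 !mxE mulrN.
Qed.

Section Determinants.
Variables (R : realType) (lam : R[i]).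
Hypothesis lam1 : `|lam| < 1.
Local Notation C := R[i].
Local Notation V := (Vfun lam).
Local Notation U := (Ufun lam).
Variable N : nat.
Local Notation k := N./2.
Implicit Types (p : nat -> C).

Definition moment_mx : 'M[C]_k.+1 := \matrix_(n, m)
  if n == m then 1 - lam / 2%:R ^+ (2 * n)
  else if (m < n)%N then - lam * 'C(2 * n, 2 * m)%:R / 2%:R ^+ (2 * n) else 0.

Definition V_moments : 'cV[C]_k.+1 := \col_n cint (fun x => V x * x%:C ^+ (2 * n)).

Lemma det_moment_mx : \det moment_mx = \prod_(n < k.+1) (1 - lam / 4%:R ^+ n).
Proof.
rewrite det_trig => [|].
  by apply: eq_bigr => n _; rewrite mxE eqxx exprM -natrX.
apply/is_trig_mxP => i j ij; rewrite mxE -(inj_eq val_inj) /=.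
by rewrite ltn_eqF// ltnNge ltnW.
Qed.

Lemma det_moment_mx_neq0 : \det moment_mx != 0.
Proof. by rewrite det_moment_mx; apply/prodf_neq0 => n _; exact: one_sub_div_neq0. Qed.

(** Row [n] holds the coordinates of the image of x^(2n), so 1 - lam A acts on row vectors of
    coefficients by multiplication on the right by [moment_mx]. *)
Lemma one_sub_op_moment_mx (n : 'I_k.+1) (x : R) :
  one_sub_op lam (fun x => 'X^(2 * n).[x%:C]) x =
  \sum_(m < k.+1) moment_mx n m * 'X^(2 * m).[x%:C].
Proof.
rewrite one_sub_op_even_power.
have nk : (n.+1 <= k.+1)%N := ltn_ord n.
rewrite (big_ord_widen _ (fun m => lam * 'C(2 * n, 2 * m)%:R / 2%:R ^+ (2 * n) * 'X^(2 * m).[x%:C]) nk).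
rewrite big_mkcond [X in _ - X](bigD1 n)//= ltnSn binn mulr1 opprD addrA.
rewrite [RHS](bigD1 n)//= mxE eqxx mulrBl mul1r -sumrN; congr (_ + _).
apply: eq_bigr => m mn; rewrite mxE eq_sym (negbTE mn) ltnS leq_eqVlt.
have -> : (m == n :> nat) = false by apply/negbTE.
by rewrite /=; case: ifP; rewrite ?mul0r ?oppr0// !mulNr.
Qed.

(** The last row is written as q T with q = p T^-1, the coefficients of the solution of (1 - lam A)
    q = p; the bordered determinant then pairs q with the moments of V. *)
Lemma det_Mmat p :
  \det (Mmat lam N p) =
  - (\prod_(n < k.+1) (1 - lam / 4%:R ^+ n) *
     ((\row_(n < k.+1) p n) *m invmx moment_mx *m V_moments) 0 0).
Proof.
rewrite -det_moment_mx -det_bordered.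
rewrite mulmxKV ?unitmxE ?unitfE ?det_moment_mx_neq0//.
(* The block matrix has size [k.+1 + 1], and [Mmat] has size [k.+2]. *)
rewrite -(det_cast (addn1 k.+1)); congr determinant; apply/matrixP => i j.
rewrite [LHS]mxE [LHS]mxE /=.
case: (split_ordP i) => i' ->; case: (split_ordP j) => j' -> /=.
- by rewrite (leq_ord i') (leq_ord j') block_mxEul mxE -!(inj_eq val_inj).
- by rewrite (leq_ord i') ord1 addn0 ltnn block_mxEur mxE.
- by rewrite (leq_ord j') ord1 addn0 ltnn block_mxEdl mxE.
- by rewrite !ord1 addn0 !ltnn block_mxEdr mxE.
Qed.

Lemma cint_U_even_poly p :
  cint (fun x => U x * \sum_(n < k.+1) p n * x%:C ^+ (2 * n)) =
  \det (Mmat lam N p) / (- \prod_(n < k.+1) (1 - lam / 4%:R ^+ n)) -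
  \sum_(n < k.+1) 2%:R * p n / ((1 - lam) * (2 * n + 1)%:R).
Proof.
pose q := \row_(n < k.+1) p n *m invmx moment_mx.
have qT : q *m moment_mx = \row_(n < k.+1) p n.
  by rewrite mulmxKV ?unitmxE ?unitfE ?det_moment_mx_neq0.
have Aq (x : R) : one_sub_op lam (fun x => (\sum_(n < k.+1) q 0 n *: 'X^(2 * n)).[x%:C]) x =
    (\sum_(n < k.+1) p n *: 'X^(2 * n)).[x%:C].
  rewrite one_sub_op_horner_sum horner_sum.
  under eq_bigr do rewrite one_sub_op_moment_mx mulr_sumr.
  rewrite exchange_big /=; apply: eq_bigr => m _.
  rewrite hornerZ; have := congr1 (fun M : 'rV_k.+1 => M 0 m) qT; rewrite !mxE => <-.
  by rewrite mulr_suml; apply: eq_bigr => n _; rewrite mulrA.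
have := cint_U_horner lam1 Aq.
have -> : cint (fun x => U x * (\sum_(n < k.+1) p n *: 'X^(2 * n)).[x%:C]) =
    cint (fun x => U x * \sum_(n < k.+1) p n * x%:C ^+ (2 * n)).
  apply: eq_cint => x _; rewrite horner_sum; congr (_ * _).
  by apply: eq_bigr => n _; rewrite hornerZ hornerXn.
move=> ->; congr (_ - _).
  rewrite det_Mmat -/q invrN mulrNN mulrAC divff ?mul1r; last first.
    by rewrite -det_moment_mx det_moment_mx_neq0.
  have -> : cint (fun x => V x * (\sum_(n < k.+1) q 0 n *: 'X^(2 * n)).[x%:C]) =
      \sum_(n < k.+1) q 0 n * cint (fun x => V x * 'X^(2 * n).[x%:C]).
    exact: cint_V_horner_sum.
  rewrite [RHS]mxE; apply: eq_bigr => n _; rewrite [V_moments _ _]mxE; congr (_ * _).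
  by apply: eq_cint => x _; rewrite hornerXn.
rewrite cint_horner_sum mulr_suml; apply: eq_bigr => n _.
rewrite cint_Xn ?mul2n ?odd_double// -mul2n [(1 - lam) * _]mulrC invfM.
by rewrite !mulrA [p n * _]mulrC.
Qed.

(** Expand along the last row, whose only nonzero entry is the 1 in column [k]; the sign is (-1)^(2k
    + 1). The minor has lost the row that contains [p]. *)
Lemma det_Mtilde p : \det (Mtilde lam N p) = - \det (Mmat lam N (fun n => (n == k)%:R)).
Proof.
have lE : (inord k.+1 : 'I_k.+2) = k.+1 :> nat by rewrite inordK.
have rE : (inord k : 'I_k.+2) = k :> nat by rewrite inordK// ltnW.
rewrite [in RHS](expand_det_row _ (inord k.+1)) (bigD1 (inord k))//= big1 ?addr0 => [|j jk].
  rewrite mxE lE rE ltnn leqnn eqxx mul1r /cofactor lE rE -signr_odd addSn /= addnn odd_double mulN1r opprK.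
  congr determinant; apply/matrixP => i j; rewrite !mxE.
  have -> : inord k.+1 = ord_max :> 'I_k.+2 by apply: val_inj; rewrite /= inordK.
  by rewrite lift_max leq_ord.
rewrite mxE lE ltnn; case: ifP => [jk'|]; last by rewrite mul0r.
have -> : (j == k :> nat) = false.
  by apply/negbTE; move: jk; apply: contraNneq => e; apply/eqP/val_inj; rewrite /= rE e.
by rewrite mul0r.
Qed.

End Determinants.

Theorem corollary2p2 (R : realType) (lam : R[i]) (hlam : `|lam| < 1) :
  let U := Ufun lam in
  let V := Vfun lam in
  let P := @Ppoly R in
  (* (i) *)
  [/\ L2_bounded_op (one_sub_op lam),
      exists S, L2_inverse (one_sub_op lam) S &
      forall S, L2_inverse (one_sub_op lam) S ->
      forall f, L2 f ->
        cint (fun x => U x * f x) =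
        cint (fun x => V x * S f x) - (1 - lam)^-1 * cint f]
  /\
  (* (ii) *)
  [/\ forall (N : nat) (p : nat -> R[i]), ~~ odd N ->
        cint (fun x => U x * \sum_(n < N./2.+1) p n * x%:C ^+ (2 * n)) =
        \det (Mmat lam N p) /
          (- \prod_(n < N./2.+1) (1 - lam / 4%:R ^+ n)) -
        \sum_(n < N./2.+1) 2%:R * p n / ((1 - lam) * (2 * n + 1)%:R),
      forall (N : nat) (p : nat -> R[i]), ~~ odd N ->
        cint (fun x => U x * x%:C ^+ N) =
        \det (Mtilde lam N p) / (\prod_(n < N./2.+1) (1 - lam / 4%:R ^+ n)) -
        2%:R / ((1 - lam) * (N + 1)%:R) &
      forall N : nat, odd N -> cint (fun x => U x * x%:C ^+ N) = 0]
  /\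
  (* (iii) *)
  [/\ forall n : nat,
        cint (fun x => U x * (P n).[x%:C]) =
        (1 - lam / 2%:R ^+ n)^-1 * cint (fun x => V x * (P n).[x%:C]) -
        2%:R * (n == 0%N)%:R / (1 - lam),
      forall N : nat, ~~ odd N ->
        cint (fun x => U x * x%:C ^+ N) =
        cint (fun x => V x * (Qpoly lam N).[x%:C]) -
        2%:R / ((1 - lam) * (N + 1)%:R),
      (* generating function, as formal power series and for |t| < pi *)
      (fun n => P n / n`!%:R) =
        fps_mul (fps_div (@fps_t {poly R[i]}) (@fps_sinh {poly R[i]}))
                (fps_exp 'X)
      /\ (forall x t : R[i], `|t| < pi%:C ->
            series (fun n => (P n).[x] * t ^+ n / n`!%:R : R[i]^o) @ \oo -->
            (t_over_sinh t * cexp (t * x) : R[i]^o)),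
      forall n : nat, P n = D_over_sinhD 'X^n &
      (P 0%N)^`() = 0 /\ forall n : nat, (P n.+1)^`() = n.+1%:R *: P n].

Proof.
move=> U V P; split; [|split].
- split; first exact: L2_bounded_one_sub.
    by exists (neumann lam); exact: L2_inverse_neumann.
  by move=> S iS f Lf; exact: L2_inverse_cint_U.
- split=> [N p eN|N p eN|N oN]; first exact: cint_U_even_poly.
    rewrite det_Mtilde.
    (* These are the coefficients of the monomial x^N. *)
    have := cint_U_even_poly hlam N (fun n => (n == N./2)%:R).
    rewrite invrN mulrN -mulNr.
    have N2 : (2 * N./2)%N = N by rewrite mul2n even_halfK.
    rewrite [X in _ - X]big_ord_recr/= [X in _ - (X + _)]big1 ?add0r => [|i _]; last first.
      by rewrite (ltn_eqF (ltn_ord i)) mulr0 mul0r.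
    rewrite eqxx mulr1 N2 => <-.
    apply: eq_cint => x _; rewrite big_ord_recr/= big1 ?add0r => [|i _]; last first.
      by rewrite (ltn_eqF (ltn_ord i)) mul0r.
    by rewrite eqxx mul1r N2.
  exact: cint_U_odd.
- split.
  + by move=> n; exact: cint_U_Ppoly.
  + by move=> N eN; exact: cint_U_Xn.
  + by split; [exact: Pcoef_gf|exact: Ppoly_gf_cvg].
  + exact: Ppoly_D_over_sinhD.
  + by split; [exact: deriv_Ppoly0|exact: deriv_Ppoly].
Qed.
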